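(* Let $\Gamma$ be an elliptic graph with NN-elliptic sequence of length $m+1$, associated cycles $C_{-1},\dots,C_m$, and minimally elliptic cycle $C$. Then $$P_0(\mathbf t_{|C|})=\sum_{j=-1}^{m-1}\mathbf t_{|C|}^{Z_K-E-C_j},$$ where $\mathbf t_{|C|}$ indicates the substitution $t_v=1$ for all $v\notin|C|$.
   Context: Let $\Gamma$ be a finite connected tree with vertex set $\mathcal V$, each vertex $v$ decorated by an integer $e_v$ (genera zero). $L=\mathbb Z\langle E_v\rangle_{v\in\mathcal V}$ with symmetric form $(E_v,E_v)=e_v$, $(E_v,E_w)=1$ for adjacent $v\ne w$, $0$ otherwise, assumed negative definite; $L'=\{l'\in L\otimes\mathbb Q:(l',L)\subset\mathbb Z\}$, $[l']$ the class in $L'/L$; $E_v^*$ with $(E_v^*,E_w)=-\delta_{vw}$; $\delta_v$ valency; $E=\sum E_v$; $\ge$ coordinatewise, $\prec$ strict in every coordinate, $l>0$ if $l\ge0,l\neq0$; $|l'|=\{v:l'_v\ne0\}$. $Z_K\in L'$ with $(Z_K,E_v)=e_v+2$; $\chi(l')=-(l',l'-Z_K)/2$. $\mathcal S'=\{l':(l',E_v)\le0\ \forall v\}$, $s_h=\min\{l'\in\mathcal S':[l']=h\}$; $Z_{min}(B)$ the minimal nonzero element of $\mathcal S'(B)\cap L(B)$ for a connected full subgraph $B$. $Z(\mathbf t)=\sum z(l')\mathbf t^{l'}$ is the Taylor expansion at $0$ of $\prod_v(1-\mathbf t^{E_v^*})^{\delta_v-2}$ ($\mathbf t^{l'}=\prod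 t_v^{l'_v}$). Canonical polynomial: $P_0(\mathbf t)=\sum_{\ell\in L,\ell\not\prec0}z(Z_K-E-\ell)\mathbf t^\ell$. Elliptic graph: $e_v\le-2$ for all $v$ and $\min_{l\in L,l>0}\chi(l)=0$. Minimally elliptic cycle: the unique $C\in L$, $C>0$, with $\chi(C)=0$ and $\chi(l)>0$ for $0<l<C$. NN-elliptic sequence: $B_{-1}=\Gamma$, $Z_{B_{-1}}=s_{[Z_K]}$, $B_0=|Z_K-s_{[Z_K]}|$; for $j\ge0$, $Z_{B_j}=Z_{min}(B_j)$, and if $Z_K-\sum_{i=-1}^jZ_{B_i}\ne0$, $B_{j+1}=|Z_K-\sum_{i=-1}^jZ_{B_i}|$; $m$ is the index with $Z_K=\sum_{i=-1}^mZ_{B_i}$. $C_j=\sum_{i=-1}^jZ_{B_i}$. *)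

(* Defs.v *)
From mathcomp Require Import all_boot all_order all_algebra.
Set Implicit Arguments. Unset Strict Implicit. Unset Printing Implicit Defensive.
Import Order.TTheory GRing.Theory Num.Theory.
Local Open Scope ring_scope.

(* Vertices: 'I_n.  Decorations e : 'I_n -> int, adjacency adj : rel 'I_n.
   Elements of L (x) Q are rational coordinate vectors w.r.t. the basis E_v;
   elements of L are the integral ones. *)
Notation qvec n := {ffun 'I_n -> rat}.
Notation zvec n := {ffun 'I_n -> int}.

Definition isIntQ (q : rat) : Prop := exists z : int, q = z%:~R.

Section Graph.
Variables (n : nat) (e : 'I_n -> int) (adj : rel 'I_n).

Definition is_tree : Prop :=
  [/\ (0 < n)%N, symmetric adj, irreflexive adj,
      (forall u w : 'I_n, connect adj u w)
    & #|[set p : 'I_n * 'I_n | adj p.1 p.2]| = (2 * n.-1)%N].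

Definition valency (v : 'I_n) : nat := #|[set w | adj v w]|.

Definition Imx : 'M[rat]_n :=
  \matrix_(u, w) (if u == w then (e u)%:~R else if adj u w then 1 else 0).

Definition form (x y : qvec n) : rat :=
  \sum_u \sum_w x u * Imx u w * y w.

Definition Ebas (v : 'I_n) : qvec n := [ffun u => if u == v then 1 else 0].

Definition neg_definite : Prop :=
  forall x : qvec n, x != 0 -> form x x < 0.

Definition zq (l : zvec n) : qvec n := [ffun u => (l u)%:~R].
Definition isInt (x : qvec n) : Prop := exists l : zvec n, x = zq l.
Definition inLdual (x : qvec n) : Prop := forall v, isIntQ (form x (Ebas v)).
Definition sameClass (x y : qvec n) : Prop := isInt (x - y).

(* E_v^star : (E_v^star, E_w) = - delta_{vw} *)
Definition Estar (v : 'I_n) : qvec n := [ffun u => - invmx Imx v u].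

(* Z_K : (Z_K, E_v) = e_v + 2 *)
Definition ZK : qvec n :=
  [ffun u => \sum_w ((e w)%:~R + 2) * invmx Imx w u].

Definition Eall : qvec n := [ffun _ => 1].

Definition chi (x : qvec n) : rat := - form x (x - ZK) / 2.

Definition leV (x y : qvec n) : Prop := forall u, x u <= y u.
Definition supp (x : qvec n) : {set 'I_n} := [set u | x u != 0].

Definition inSdual (x : qvec n) : Prop :=
  inLdual x /\ forall v, form x (Ebas v) <= 0.

Definition is_sZK (s : qvec n) : Prop :=
  [/\ inSdual s, sameClass s ZK &
      forall y, inSdual y -> sameClass y ZK -> leV s y].

Definition inSL_B (B : {set 'I_n}) (x : qvec n) : Prop :=
  [/\ isInt x, supp x \subset B & forall v, v \in B -> form x (Ebas v) <= 0].

Definition is_Zmin (B : {set 'I_n}) (Z : qvec n) : Prop :=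
  [/\ inSL_B B Z, Z != 0 &
      forall Y, inSL_B B Y -> Y != 0 -> leV Z Y].

Definition is_min_ell_cycle (C : qvec n) : Prop :=
  [/\ isInt C, leV 0 C, C != 0, chi C = 0 &
      forall l, isInt l -> leV 0 l -> l != 0 -> leV l C -> l != C -> 0 < chi l].

Definition elliptic : Prop :=
  (forall v, e v <= -2) /\
  (forall l, isInt l -> leV 0 l -> l != 0 -> 0 <= chi l) /\
  (exists l, [/\ isInt l, leV 0 l, l != 0 & chi l = 0]).

(* partial sums C_j; with the shift k = j + 1, Csum Zs k = C_{k-1}
   = Zs 0 + ... + Zs k, where Zs 0 = Z_{B_{-1}} and Zs (i+1) = Z_{B_i} *)
Definition Csum (Zs : nat -> qvec n) (k : nat) : qvec n :=
  \sum_(i < k.+1) Zs i.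

(* NN-elliptic sequence with last index m = M - 1 (M = m + 1 >= 0):
   Z_{B_{-1}} = s_{[Z_K]}; for 0 <= j <= m, Z_K - C_{j-1} != 0,
   B_j = |Z_K - C_{j-1}| and Z_{B_j} = Z_min(B_j); finally Z_K = C_m. *)
Definition is_NN_seq (M : nat) (Zs : nat -> qvec n) : Prop :=
  [/\ is_sZK (Zs 0%N),
      (forall k, (0 < k <= M)%N ->
         ZK - Csum Zs k.-1 != 0 /\ is_Zmin (supp (ZK - Csum Zs k.-1)) (Zs k))
    & ZK = Csum Zs M].

(* coefficient of x^k in (1 - x)^a, a : int (Taylor expansion at 0) *)
Definition cpow (a : int) (k : nat) : int :=
  match a with
  | Posz p => (-1) ^+ k * ('C(p, k))%:Z
  | Negz q => ('C(q + k, k))%:Z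
  end.

(* bound on exponents k_v in Z(t): since all entries of E_v^star are >= 0 and
   (E_v^star)_v > 0 (negative definite connected graph), any k in N^V with
   sum_v k_v E_v^star = l has k_v <= l_v / (E_v^star)_v < zbound l. *)
Definition zbound (l : qvec n) : nat :=
  (\sum_v Num.truncn (l v / Estar v v)).+1.

(* z(l) = coefficient of t^{l} in prod_v (1 - t^{E_v^star})^{delta_v - 2} *)
Definition zcoef (l : qvec n) : int :=
  \sum_(k : {ffun 'I_n -> 'I_(zbound l)} |
          [forall u, \sum_v ((k v : nat)%:R * Estar v u) == l u])
     \prod_v cpow ((valency v)%:Z - 2) (k v).

Definition P0coef (ell : zvec n) : int :=
  if [forall u, ell u < 0] then 0 else zcoef (ZK - Eall - zq ell).

End Graph.

(* Main.v *)
(** Write l' = Z_K + d with d in L. The coordinates of l' in the E_v^star are -(l', E_v), so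
z(l') is a product over v of one-variable coefficients, and vanishes unless l' is in S'. The
exponent ell of P_0 corresponds to d = -1 - ell, and ell < 0 in all coordinates means d >= 0.

If d >= 0 on |C| and z(l') <> 0, the negative part of d satisfies chi <= 0 and avoids |C|;
since every cycle > 0 with chi = 0 contains C, it vanishes, so the term is not in P_0.

Otherwise all terms of the fibre over d|_C occur, and they are summed by removing the vertices
outside |C| one leaf at a time: the factor of a leaf v is the indicator of (l', E_v) <= 0, which
is monotone in the coordinate at v because v is not in |C|, and the resulting partial sum lowers
the valency of the neighbour by one. What remains is the product over |C|, valencies in |C|,
at the minimal extension s of d|_C with (Z_K + s, E_v) <= 0 off |C|. If it is nonzero then
Z_K + s is in S'; comparing s with the elements C_j - Z_K step by step along the sequence, by
minimality of each Z_min(B_j), forces s = C_j - Z_K for some j < m, where all exponents on |C|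
are 0 and the product is 1. *)

Require Import Defs.
From mathcomp Require Import all_boot all_order all_algebra.
From mathcomp Require Import zify ring.
Set Implicit Arguments. Unset Strict Implicit. Unset Printing Implicit Defensive.
Import Order.TTheory GRing.Theory Num.Theory.
Local Open Scope ring_scope.

(** * Symmetric forms with nonnegative off-diagonal entries *)

Section Bilinear.
Variables (R : realDomainType) (n : nat) (A : 'I_n -> 'I_n -> R).
Implicit Types x y z : {ffun 'I_n -> R}.

Definition dot x v : R := \sum_u x u * A u v.
Definition bil x y : R := \sum_v dot x v * y v.
Definition unitv (v : 'I_n) : {ffun 'I_n -> R} := [ffun u => (u == v)%:R].
Definition negpart x : {ffun 'I_n -> R} := [ffun u => if x u < 0 then - x u else 0].

Lemma unitv_id v : unitv v v = 1.
Proof. by rewrite ffunE eqxx. Qed.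

Lemma unitv_neq u v : u != v -> unitv v u = 0.
Proof. by rewrite ffunE => /negbTE->. Qed.

Lemma dotD x y v : dot (x + y) v = dot x v + dot y v.
Proof. by rewrite -big_split; apply: eq_bigr => u _; rewrite ffunE mulrDl. Qed.

Lemma dotN x v : dot (- x) v = - dot x v.
Proof. by rewrite -sumrN; apply: eq_bigr => u _; rewrite ffunE mulNr. Qed.

Lemma dotB x y v : dot (x - y) v = dot x v - dot y v.
Proof. by rewrite dotD dotN. Qed.

Lemma dot0 v : dot 0 v = 0.
Proof. by apply: big1 => u _; rewrite ffunE mul0r. Qed.

Lemma dot_unitv u v : dot (unitv u) v = A u v.
Proof.
rewrite /dot (bigD1 u) //= big1 ?addr0 ?unitv_id ?mul1r // => w neq_wu.
by rewrite unitv_neq ?mul0r.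
Qed.

Lemma dotMn x k v : dot (x *+ k) v = dot x v *+ k.
Proof. by elim: k => [|k IHk]; rewrite ?mulr0n ?dot0 // !mulrS dotD IHk. Qed.

Lemma bilDl x y z : bil (x + y) z = bil x z + bil y z.
Proof. by rewrite -big_split; apply: eq_bigr => u _; rewrite dotD mulrDl. Qed.

Lemma bilDr x y z : bil x (y + z) = bil x y + bil x z.
Proof. by rewrite -big_split; apply: eq_bigr => u _; rewrite ffunE mulrDr. Qed.

Lemma bilNl x y : bil (- x) y = - bil x y.
Proof. by rewrite -sumrN; apply: eq_bigr => u _; rewrite dotN mulNr. Qed.

Lemma bil_unitv x v : bil x (unitv v) = dot x v.
Proof.
rewrite /bil (bigD1 v) //= big1 ?addr0 ?unitv_id ?mulr1 // => w neq_wv.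
by rewrite unitv_neq ?mulr0.
Qed.

Hypothesis symA : forall u v, A u v = A v u.
Hypothesis A_ge0 : forall u v, u != v -> 0 <= A u v.

Lemma bilC x y : bil x y = bil y x.
Proof.
rewrite /bil /dot; under eq_bigr do rewrite mulr_suml.
rewrite exchange_big; apply: eq_bigr => u _; rewrite mulr_suml.
by apply: eq_bigr => v _; rewrite symA; ring.
Qed.

Lemma ler_dot x y v : (forall u, u != v -> x u <= y u) -> x v = y v ->
  dot x v <= dot y v.
Proof.
move=> lexy eqv; apply: ler_sum => u _; have [->|neq_uv] := eqVneq u v.
  by rewrite eqv.
by rewrite ler_wpM2r ?A_ge0 ?lexy.
Qed.

Lemma dot_ge0 x v : (forall u, 0 <= x u) -> x v = 0 -> 0 <= dot x v.
Proof.
by move=> x_ge0 xv0; rewrite -(dot0 v); apply: ler_dot => [u _|]; rewrite ffunE.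
Qed.

Lemma bil_ge0 x y : (forall u, 0 <= x u) -> (forall u, 0 <= y u) ->
  (forall u, x u = 0 \/ y u = 0) -> 0 <= bil x y.
Proof.
move=> x0 y0 dxy; apply: sumr_ge0 => v _.
by have [xv|->] := dxy v; rewrite ?mulr0 // mulr_ge0 ?dot_ge0.
Qed.

Lemma negpart_ge0 x u : 0 <= negpart x u.
Proof. by rewrite ffunE; case: ltP => // /ltW; rewrite oppr_ge0. Qed.

Lemma negpart_eq0 x : negpart x = 0 -> forall u, 0 <= x u.
Proof.
move=> xn0 u; have := congr1 (fun f : {ffun 'I_n -> R} => f u) xn0.
by rewrite !ffunE; case: ltP => // xu /eqP; rewrite oppr_eq0 => /eqP xu0; rewrite xu0 ltxx in xu.
Qed.

(** [x + negpart x] is the positive part of [x]; its support is disjoint from that of [negpart x],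
    so the two pair nonnegatively. *)
Lemma bil_negpart x : - bil (negpart x) (negpart x) <= bil x (negpart x).
Proof.
rewrite -bilNl -subr_ge0 -bilNl -bilDl opprK bil_ge0 // => u; rewrite !ffunE.
- by case: ltP => [|x0]; rewrite ?subrr ?addr0 ?addrN.
- by case: ltP => // /ltW; rewrite oppr_ge0.
- by case: ltP => [|x0]; rewrite ?subrr ?addr0 ?addrN; [left|right].
Qed.

Hypothesis negA : forall x, x != 0 -> bil x x < 0.

(** If the negative part were nonzero, negative definiteness would make its pairing with [x]
    positive, whereas by hypothesis every term of that pairing is at most 0. *)
Lemma antinef_ge0 x : (forall v, x v < 0 -> dot x v <= 0) -> forall v, 0 <= x v.
Proof.
move=> xS; apply: negpart_eq0; apply/eqP/negPn/negP => /negA; apply/negP; rewrite -leNgt -oppr_le0.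
apply: le_trans (bil_negpart x) _; apply: sumr_le0 => v _; rewrite ffunE.
by case: ltP => [xv|]; rewrite ?mulr0 // mulr_le0_ge0 ?xS // oppr_ge0 ltW.
Qed.

End Bilinear.

(** * Cycles with chi = 0 *)

Section EllipticLattice.
Variables (n : nat) (A : 'I_n -> 'I_n -> int).
Implicit Types (x y z d l : zvec n) (T : {set 'I_n}).
Local Notation dot := (dot A).
Local Notation bil := (bil A).
Local Notation E_ v := (unitv int v).

Lemma vaddE x y u : (x + y) u = x u + y u. Proof. by rewrite ffunE. Qed.
Lemma voppE x u : (- x) u = - x u. Proof. by rewrite ffunE. Qed.
Lemma vmulnE x k u : (x *+ k) u = x u * k%:Z.
Proof. by rewrite ffunMnE -mulr_natr natz. Qed.
Definition vE := (vaddE, voppE, vmulnE).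

Lemma unitz_id (v : 'I_n) : E_ v v = 1 :> int. Proof. exact: unitv_id. Qed.

(* Twice chi, so as to stay in the integers. *)
Definition chi2 x : int := \sum_v x v * (A v v + 2) - bil x x.

(* The exponent of the v-th factor of z(ZK + d): minus (ZK + d, E_v). *)
Definition expo d v : int := - (A v v + 2) - dot d v.

Definition vmin x y : zvec n := [ffun u => Num.min (x u) (y u)].

Lemma expoD x y v : expo (x + y) v = expo x v - dot y v.
Proof. by rewrite /expo dotD; ring. Qed.

(** Termination of computation sequences: adding some [E_v] while staying below [U] lowers the total
    distance to [U]. *)
Lemma vec_ascent (U : zvec n) (P : zvec n -> Prop) :
  (forall x, (forall u, x u <= U u) ->
     (forall v, (forall u, (x + E_ v) u <= U u) -> P (x + E_ v)) -> P x) ->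
  forall x, (forall u, x u <= U u) -> P x.
Proof.
move=> IH x; move Dk: (\sum_u absz (U u - x u)%R)%N => k.
elim/ltn_ind: k x Dk => k IHk x Dk lexU; apply: IH => // v lexvU.
apply: (IHk (\sum_u absz (U u - (x + E_ v) u)%R)%N) => //.
rewrite -Dk (bigD1 v) //= [X in (_ < X)%N](bigD1 v) //= -addSn leq_add //.
  by move: (lexvU v) (lexU v); rewrite !vE unitz_id; lia.
apply: leq_sum => u neq_uv; move: (lexvU u) (lexU u).
by rewrite !vE (unitv_neq _ neq_uv); lia.
Qed.

Hypothesis symA : forall u v, A u v = A v u.
Hypothesis A_ge0 : forall u v, u != v -> 0 <= A u v.
Hypothesis negA : forall x, x != 0 -> bil x x < 0.
Hypothesis diagA : forall v, A v v <= -2.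

Lemma chi2D x y : chi2 (x + y) = chi2 x + chi2 y - 2 * bil x y.
Proof.
rewrite /chi2 bilDl !bilDr (bilC symA y x).
under eq_bigr do rewrite ffunE mulrDl.
by rewrite big_split /=; ring.
Qed.

Lemma chi2_unitv v : chi2 (E_ v) = 2.
Proof.
rewrite /chi2 bil_unitv dot_unitv (bigD1 v) //= big1 ?unitz_id => [|u neq_uv].
  by ring.
by rewrite unitv_neq ?mul0r.
Qed.

Lemma chi2D_unitv x v : chi2 (x + E_ v) = chi2 x + 2 - 2 * dot x v.
Proof. by rewrite chi2D chi2_unitv bil_unitv. Qed.

Lemma chi2_opp x : chi2 (- x) = \sum_v x v * expo x v.
Proof.
rewrite /chi2 bilNl (bilC symA) bilNl opprK /bil -sumrB; apply: eq_bigr => v _.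
by rewrite ffunE /expo; ring.
Qed.

(** Writing [x = m + a] and [y = m + b] with [m] the minimum, the two sides differ by [2 (a, b)],
    where [a], [b] are nonnegative with disjoint supports. *)
Lemma chi2_submod x y : chi2 (vmin x y) + chi2 (x + y - vmin x y) <= chi2 x + chi2 y.
Proof.
set m := vmin x y; pose a : zvec n := x - m; pose b : zvec n := y - m.
have -> : x + y - m = m + (a + b) by apply/ffunP=> u; rewrite /a /b !vE; ring.
have Dx: x = m + a by apply/ffunP=> u; rewrite /a !vE; ring.
have Dy: y = m + b by apply/ffunP=> u; rewrite /b !vE; ring.
have ab_ge0: 0 <= bil a b by apply: bil_ge0 => // u; rewrite !vE ffunE; lia.
clearbody a b m; rewrite Dx Dy !chi2D bilDr; lia.
Qed.

Lemma ler_expo x y u : (forall v, v != u -> y v <= x v) -> y u = x u -> expo x u <= expo y u.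
Proof. by move=> le_yx eq_yx; rewrite lerD2l lerN2 ler_dot. Qed.

(** Equality of [x] and [y] at [u] would give [(x, E_u) <= (y, E_u)], against the signs of the two
    exponents; so there is room for one more [E_u]. *)
Lemma laufer_step x y u : (forall v, x v <= y v) -> expo x u < 0 -> 0 <= expo y u ->
  forall v, (x + E_ u) v <= y v.
Proof.
move=> lexy xu yu v; rewrite vaddE; have [->|neq_vu] := eqVneq v u; last first.
  by rewrite unitv_neq ?addr0.
rewrite unitz_id.
have := lexy u; rewrite le_eqVlt => /orP[/eqP eq_xy|]; last by lia.
have := ler_dot A_ge0 (fun v _ => lexy v) eq_xy.
by move: xu yu; rewrite /expo; lia.
Qed.

Lemma expo_vmin x y u : 0 <= expo x u -> 0 <= expo y u -> 0 <= expo (vmin x y) u.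
Proof.
rewrite /expo => xu yu; have [lexy|/ltW leyx] := leP (x u) (y u).
  suff : dot (vmin x y) u <= dot x u by lia.
  by apply: ler_dot => // [v _|]; rewrite ffunE ?ge_min ?lexx // min_l.
suff : dot (vmin x y) u <= dot y u by lia.
by apply: ler_dot => // [v _|]; rewrite ffunE ?ge_min ?lexx ?orbT // min_r.
Qed.

(** * Minimal extensions: coordinates prescribed on [T], anti-nefness of [Z_K + y] required off
    [T] *)

Definition adm (T : {set 'I_n}) d y :=
  (forall u, u \in T -> y u = d u) /\ (forall u, u \notin T -> 0 <= expo y u).

Definition is_ext (T : {set 'I_n}) d y :=
  adm T d y /\ forall z, adm T d z -> forall u, y u <= z u.

Lemma adm_vmin T d1 d2 y1 y2 : (forall u, u \in T -> d1 u <= d2 u) ->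
  adm T d1 y1 -> adm T d2 y2 -> adm T d1 (vmin y1 y2).
Proof.
move=> le_d [y1T y1N] [y2T y2N]; split=> u uT; last by rewrite expo_vmin ?y1N ?y2N.
by rewrite ffunE y1T // y2T //; move: (le_d u uT); lia.
Qed.

Lemma ext_mono T d1 d2 y1 y2 : (forall u, u \in T -> d1 u <= d2 u) ->
  is_ext T d1 y1 -> adm T d2 y2 -> forall u, y1 u <= y2 u.
Proof.
move=> le_d [adm1 min1] adm2 u.
by have := min1 _ (adm_vmin le_d adm1 adm2) u; rewrite ffunE; lia.
Qed.

Variable D : zvec n.
Hypothesis dotD_lt0 : forall v, dot D v < 0.

Lemma antinefD_gt0 v : 0 < D v.
Proof.
have D0 u : 0 <= D u by apply: (antinef_ge0 A_ge0 negA) => w _; exact: ltW.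
rewrite lt_neqAle D0 andbT; apply/eqP => Dv.
by have := dot_ge0 A_ge0 D0 (esym Dv); have := dotD_lt0 v; lia.
Qed.

(** For large [N], [y + N D] is nonnegative on [T] and anti-nef off [T], hence nonnegative
    everywhere by [antinef_ge0]. *)
Lemma expo_ge0_bounded T d : exists L : zvec n, forall y, adm T d y -> forall u, L u <= y u.
Proof.
pose N := (\sum_v (`|d v| + `|A v v|))%N.
have leN v : (`|d v| + `|A v v| <= N)%N by rewrite /N (bigD1 v) //= leq_addr.
exists (- (D *+ N)) => y [yT yN] u.
suff : 0 <= (y + D *+ N) u by rewrite !vE; lia.
apply: (antinef_ge0 A_ge0 negA) => {u} v; rewrite !vE dotD dotMn -mulr_natr natz.
have := leN v; have := antinefD_gt0 v; have := dotD_lt0 v.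
case vT: (v \in T); first by rewrite yT //; nia.
by move: (yN v (negbT vT)); rewrite /expo; nia.
Qed.

Lemma adm_exists T d : exists y, adm T d y.
Proof.
pose N := (\sum_v (`|D v| + `|d v|) * \sum_v \sum_u `|A u v|)%N.
(* On [T] the multiple of [D] is cancelled. Off-diagonal entries being nonnegative, this can only
   lower the pairings with [E_u] for [u] off [T]. *)
pose dT : zvec n := [ffun u => if u \in T then d u - D u * N%:Z else 0].
exists (dT + D *+ N); 
split=> u uT; first by rewrite !vE ffunE uT; ring.
have le_dT : dot dT u <= N%:Z.
  rewrite /N; apply: (@le_trans _ _ (\sum_v ((`|D v| + `|d v|) * `|A v u|)%N%:Z)).
    apply: ler_sum => v _; rewrite !ffunE; case: ifP => [vT|_]; last by lia.
    have Avu : 0 <= A v u by apply: A_ge0; apply: contraNneq uT => <-.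
    have := antinefD_gt0 v; nia.
  rewrite -(big_morph Posz PoszD (erefl 0)) lez_nat.
  apply: leq_sum => v _; rewrite leq_mul2l; apply/orP; right.
  rewrite (bigD1 u) //= (bigD1 v) //=; lia.
rewrite /expo dotD dotMn -mulr_natr natz.
have := dotD_lt0 u; have := diagA u; nia.
Qed.

(** Laufer's algorithm: start below every admissible vector and add [E_u], [u] off [T], while the
    exponent at [u] is negative; [laufer_step] keeps the sequence below every admissible vector. *)
Lemma ext_exists T d : exists y, is_ext T d y.
Proof.
have [L leL] := expo_ge0_bounded T d; have [U admU] := adm_exists T d.
pose start : zvec n := [ffun u => if u \in T then d u else L u].
pose P x := (forall u, u \in T -> x u = d u) -> (forall z, adm T d z -> forall u, x u <= z u) ->
  exists y, is_ext T d y.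
have le_start z : adm T d z -> forall u, start u <= z u.
  by move=> admz u; rewrite ffunE; case: ifP => uT; [case: admz => ->|exact: leL].
apply: (@vec_ascent U P _ start) => [x lexU IHx xT xmin | |u uT|]; [|exact: le_start| |exact: le_start].
- have [/existsP[u /andP[uT xu]]|/existsPn noneg] :=
    boolP [exists u, (u \notin T) && (expo x u < 0)].
    have step z : adm T d z -> forall v, (x + E_ u) v <= z v.
      by move=> admz; apply: laufer_step => //; [exact: xmin|case: admz => _; exact].
    apply: (IHx u) => // [|v vT]; first exact: step.
    rewrite vaddE xT // unitv_neq ?addr0 //.
    by apply: contraNneq uT => <-.
  exists x; split=> //; split=> // u uT.
  by have := noneg u; rewrite uT /= -leNgt.
by rewrite ffunE uT.
Qed.

(** * Containment of the minimally elliptic cycle *)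

Hypothesis connA : forall P : pred 'I_n, (exists u, P u) -> (exists u, ~~ P u) ->
  exists u w, [/\ P u, ~~ P w & 0 < A w u].
Hypothesis ellA : forall x, (forall u, 0 <= x u) -> 0 <= chi2 x.
Variable C : zvec n.
Hypothesis C_ge0 : forall u, 0 <= C u.
Hypothesis C_neq0 : C != 0.
Hypothesis chi2C : chi2 C = 0.
Hypothesis C_min : forall l, (forall u, 0 <= l u) -> l != 0 ->
  (forall u, l u <= C u) -> l != C -> 0 < chi2 l.

Lemma nonzero_entry x : x != 0 -> exists u, x u != 0.
Proof.
move=> x_neq0; have [/existsP //|/existsPn x0] := boolP [exists u, x u != 0].
by case/negP: x_neq0; apply/eqP/ffunP => u; rewrite ffunE; apply/eqP; have := x0 u; rewrite negbK.
Qed.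

(** The minimum of [l] and [C] is nonzero. Were it not [C], its [chi2] would be positive, and
    submodularity would make [chi2] of the maximum negative. *)
Lemma C_le_of_meet l v : (forall u, 0 <= l u) -> chi2 l <= 0 -> 0 < l v -> 0 < C v ->
  forall u, C u <= l u.
Proof.
move=> l_ge0 chi_l lv Cv; pose m := vmin l C.
have m_ge0 u : 0 <= m u by rewrite ffunE le_min l_ge0 C_ge0.
have m_leC u : m u <= C u by rewrite ffunE ge_min lexx orbT.
have m_lel u : m u <= l u by rewrite ffunE ge_min lexx.
have m_neq0 : m != 0.
  by apply/eqP=> /(congr1 (fun f : zvec n => f v)); rewrite !ffunE; lia.
suff <- : m = C by [].
apply/eqP/negPn/negP => m_neqC; have chi_m := C_min m_ge0 m_neq0 m_leC m_neqC.
have := chi2_submod l C; rewrite -/m chi2C.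
suff : 0 <= chi2 (l + C - m) by lia.
by apply: ellA => u; rewrite !vE; move: (m_leC u) (l_ge0 u); lia.
Qed.

(** At a vertex [w] outside the support but adjacent to it, [(x, E_w)] would be positive. *)
Lemma antinef_pos x : (forall u, 0 <= x u) -> x != 0 -> (forall u, dot x u <= 0) ->
  forall u, 0 < x u.
Proof.
move=> x0 /nonzero_entry[u0 xu0] xS u; rewrite lt_neqAle x0 andbT eq_sym.
apply/eqP=> xu.
have [u1 [w [xu1 xw Awu]]] : exists u w, [/\ x u != 0, ~~ (x w != 0) & 0 < A w u].
  by apply: connA; [exists u0 | exists u; rewrite xu].
have xu1_gt0 : 0 < x u1 by rewrite lt_neqAle eq_sym xu1 x0.
have := xS w; apply/negP; rewrite -ltNge /dot (bigD1 u1) //= addrC ltr_wpDl //.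
  apply: sumr_ge0 => v _; have [->|neq_vw] := eqVneq v w.
    by move: xw; rewrite negbK => /eqP->; rewrite mul0r.
  by rewrite mulr_ge0 ?x0 ?A_ge0.
by rewrite mulr_gt0 // symA.
Qed.

Lemma exists_C_pos : exists u, 0 < C u.
Proof. by have [u Cu] := nonzero_entry C_neq0; exists u; rewrite lt_neqAle eq_sym Cu C_ge0. Qed.

(* A cycle with chi = 0 is pushed upwards by Laufer steps, along which chi stays 0, until
   it is anti-nef and so meets C; containment of C is then pulled back one step at a time. *)
Lemma C_le l : (forall u, 0 <= l u) -> l != 0 -> chi2 l <= 0 -> forall u, C u <= l u.
Proof.
pose N := (\sum_v `|l v|)%N.
have : forall u, l u <= (D *+ N) u.
  move=> u; rewrite vmulnE; have := antinefD_gt0 u.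
  have : (`|l u| <= N)%N by rewrite /N (bigD1 u) //= leq_addr.
  nia.
apply: (@vec_ascent (D *+ N) (fun x => (forall u, 0 <= x u) -> x != 0 -> chi2 x <= 0 ->
  forall u, C u <= x u)) => x le_xU IHx x_ge0 x_neq0 chi_x.
have [/existsP[v dot_v]|/existsPn noneg] := boolP [exists v, 0 < dot x v]; last first.
  have [u Cu] := exists_C_pos; apply: (C_le_of_meet (v := u)) => //.
  by apply: antinef_pos => // w; rewrite leNgt.
have lt_xU : x v < (D *+ N) v.
  rewrite lt_neqAle le_xU andbT; apply/eqP => eq_xU.
  have := ler_dot A_ge0 (fun u _ => le_xU u) eq_xU.
  by rewrite dotMn -mulr_natr natz; have := dotD_lt0 v; nia.
have le_step u : (x + E_ v) u <= (D *+ N) u.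
  rewrite vaddE; have [->|neq_uv] := eqVneq u v; first by rewrite unitz_id; lia.
  by rewrite unitv_neq // addr0.
have step_ge0 u : 0 <= (x + E_ v) u.
  by rewrite vaddE addr_ge0 // ffunE; case: eqP.
have C_le_step : forall u, C u <= (x + E_ v) u.
  apply: IHx => //; last by rewrite chi2D_unitv; lia.
  apply/eqP=> /(congr1 (fun f : zvec n => f v)); rewrite vaddE unitz_id ffunE.
  by have := x_ge0 v; lia.
have [/existsP[u /andP[xu Cu]]|/existsPn nomeet] := boolP [exists u, (0 < x u) && (0 < C u)].
  exact: (C_le_of_meet (v := u)).
(* Now [C <= x + E_v] while [x] and [C] have disjoint supports, which leaves only [E_v], whose
   [chi2] is 2. *)
suff CE : C = E_ v by have := chi2C; rewrite CE chi2_unitv.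
have Cu0 u : u != v -> C u = 0.
  move=> neq_uv; have := C_le_step u; rewrite vaddE unitv_neq // addr0.
  by have := nomeet u; have := C_ge0 u; lia.
apply/ffunP=> u; have [->|neq_uv] := eqVneq u v; last by rewrite Cu0 ?unitv_neq.
have [w Cw] := exists_C_pos; have eq_wv : w = v.
  by apply/eqP/negPn/negP => /Cu0; lia.
have := nomeet v; have := C_le_step v; have := x_ge0 v.
by rewrite eq_wv in Cw; rewrite vaddE !unitz_id; move: (C v) (x v) Cw; lia.
Qed.

(** The negative part [q] of [d] satisfies [chi2 q <= - sum q_v expo_v <= 0]. If nonzero it would
    contain [C], but it vanishes on |C|. *)
Lemma expo_ge0_nonneg d : (forall v, 0 <= expo d v) -> (forall v, C v != 0 -> 0 <= d v) ->
  forall v, 0 <= d v.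
Proof.
move=> dK d_ge0; apply: negpart_eq0; apply/eqP/negPn/negP => dn_neq0.
pose q : zvec n := negpart d.
have q_ge0 u : 0 <= q u by exact: negpart_ge0.
have chi_le0 : chi2 q <= 0.
  rewrite /chi2; have : - bil q q <= bil d q by exact: bil_negpart.
  suff : bil d q <= - \sum_v q v * (A v v + 2).
    by move: (bil q q) (bil d q) (\sum_v _); lia.
  rewrite -sumrN; apply: ler_sum => v _.
  by have := dK v; have := q_ge0 v; rewrite /expo; move: (q v) (dot d v); nia.
have [u Cu] := exists_C_pos; have := C_le q_ge0 dn_neq0 chi_le0 u.
have : 0 <= d u by apply: d_ge0; lia.
by rewrite /q ffunE leNgt => /negbTE->; lia.
Qed.

(* Along the computation sequence from y + E_v to its extension y2, chi does not increase, so
   the difference r has chi <= 1. If expo dropped at v then (r, E_v) >= 1, and adding E_v and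
   a neighbour E_w in T would give a cycle with chi <= 0 that does not contain C. *)
Lemma expo_ext_mono T d1 d2 y1 y2 v w :
  v \notin T -> w \in T -> 0 < A v w -> (forall u, u \notin T -> C u = 0) ->
  (forall u, u \in T -> d2 u = d1 u) -> d2 v = d1 v + 1 ->
  is_ext (v |: T) d1 y1 -> is_ext (v |: T) d2 y2 -> expo y1 v <= expo y2 v.
Proof.
move=> vT wT Avw C_T d_T d_v ext1 ext2; rewrite leNgt; apply/negP => lt_expo.
have neq_wv : w != v by apply: contraNneq vT => <-.
have le12 : forall u, y1 u <= y2 u.
  apply: (ext_mono _ ext1 (proj1 ext2)) => u; rewrite in_setU1.
  by case/orP=> [/eqP->|/d_T->]; rewrite ?d_v // lerDl.
have [[y1T y1N] _] := ext1; have [[y2T y2N] min2] := ext2.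
pose r : zvec n := y2 - y1.
have Dy2 : y2 = y1 + r by apply/ffunP=> u; rewrite !vE; ring.
have r_ge0 u : 0 <= r u by rewrite !vE subr_ge0.
have r_T u : u \in T -> r u = 0.
  by move=> uT; rewrite !vE y1T ?y2T ?d_T ?subrr // in_setU1 uT orbT.
have r_v : r v = 1 by rewrite !vE y1T ?y2T ?d_v ?in_setU1 ?eqxx //; ring.
clearbody r; have Ev_r u : E_ v u <= r u.
  by have [->|neq_uv] := eqVneq u v; rewrite ?unitz_id ?r_v // unitv_neq.
have chi_r : chi2 r <= 2.
  suff : forall x, (forall u, x u <= r u) -> (forall u, E_ v u <= x u) -> chi2 x <= 2 -> chi2 r <= 2.
    by move=> climb; apply: (climb (E_ v)) => //; rewrite chi2_unitv.
  apply: vec_ascent => x le_xr IHx Ev_x chi_x.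
  have x_T u : u \in v |: T -> (y1 + x) u = d2 u.
    rewrite in_setU1 => /predU1P uvT; rewrite -(y2T u) ?in_setU1; last first.
      by case: uvT => [->|->]; rewrite ?eqxx ?orbT.
    suff : r u <= x u by rewrite Dy2 !vaddE; move: (le_xr u); lia.
    case: uvT => [->|uT]; first by rewrite r_v; have := Ev_x v; rewrite unitz_id.
    rewrite r_T //; apply: le_trans (Ev_x u); rewrite unitv_neq //.
    by apply: contraNneq vT => <-.
  have [/existsP[u /andP[uT xu]]|/existsPn noneg] :=
    boolP [exists u, (u \notin v |: T) && (expo (y1 + x) u < 0)]; last first.
    suff -> : r = x by [].
    apply/ffunP=> u; suff : r u <= x u by move: (r u) (x u) (le_xr u); lia.
    have adm_x : adm (v |: T) d2 (y1 + x).
      by split=> // z zT; have := noneg z; rewrite zT /= -leNgt.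
    by have := min2 _ adm_x u; rewrite Dy2 !vaddE; move: (y1 u) (r u) (x u); lia.
  have dot_x : 1 <= dot x u by move: xu (y1N u uT); rewrite expoD; lia.
  have le_step (z : 'I_n) : (x + E_ u) z <= r z.
    have le_y12 t : (y1 + x) t <= y2 t by rewrite Dy2 !vaddE lerD2l.
    have := laufer_step le_y12 xu (y2N u uT) z.
    by rewrite Dy2 !vaddE; move: (E_ u z) (x z) (r z) (y1 z); lia.
  apply: (IHx u) => // [z|]; last by rewrite chi2D_unitv; lia.
  rewrite vaddE; apply: le_trans (Ev_x z) _; rewrite lerDl.
  by rewrite ffunE; case: eqP.
have dot_r : 1 <= dot r v by move: lt_expo; rewrite Dy2 expoD; lia.
pose q := r + E_ v.
have q_ge0 u : 0 <= q u.
  by rewrite vaddE addr_ge0 // ffunE; case: eqP.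
have q_w : q w = 0 by rewrite vaddE r_T // unitv_neq // addr0.
(* [chi2 q <= 2] since [(r, E_v) >= 1]; the coordinate 2 of [q] at the neighbour [v] of [w] then
   brings [chi2 (q + E_w)] down to at most 0. *)
have dot_q : 2 <= dot q w.
  rewrite /dot (bigD1 v) //=; have -> : q v = 2 by rewrite vaddE r_v unitz_id.
  suff : 0 <= \sum_(i < n | i != v) q i * A i w.
    by move: (\sum_(i < n | i != v) q i * A i w) Avw; lia.
  apply: sumr_ge0 => u _; have [->|neq_uw] := eqVneq u w; first by rewrite q_w mul0r.
  by rewrite mulr_ge0 ?A_ge0.
have C_q : forall u, C u <= (q + E_ w) u.
  apply: C_le; first by move=> u; rewrite vaddE addr_ge0 // ffunE; case: eqP.
    apply/eqP=> /(congr1 (fun f : zvec n => f w)); rewrite vaddE q_w unitz_id ffunE; lia.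
  rewrite chi2D_unitv /q chi2D_unitv -/q; lia.
(* [C] lives on [T], where [q] vanishes, so [C <= q + E_w] leaves only [E_w]. *)
suff CE : C = E_ w by have := chi2C; rewrite CE chi2_unitv.
have Cu0 u : u != w -> C u = 0.
  move=> neq_uw; case uT: (u \in T); last by apply: C_T; rewrite uT.
  have := C_q u; have := C_ge0 u; rewrite !vaddE r_T // !unitv_neq //; last first.
    by apply: contraNneq vT => <-.
  by rewrite !addr0; lia.
apply/ffunP=> u; have [->|neq_uw] := eqVneq u w; last by rewrite Cu0 ?unitv_neq.
have [t Ct] := exists_C_pos; have eq_tw : t = w.
  by apply/eqP/negPn/negP => /Cu0; lia.
have := C_q w; rewrite eq_tw in Ct; rewrite vaddE q_w !unitz_id.
by move: (C w) Ct; lia.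
Qed.

Definition restr (P : pred 'I_n) x : zvec n := [ffun u => if P u then x u else 0].

(** Otherwise [x] splits into two orthogonal nonzero parts. Their [chi2] are nonnegative with sum at
    most 0, so both parts contain [C] although their supports are disjoint. *)
Lemma supp_connected x (P : pred 'I_n) : (forall u, 0 <= x u) -> chi2 x <= 0 ->
  (exists2 u, x u != 0 & P u) -> (exists2 u, x u != 0 & ~~ P u) ->
  exists u w, [/\ x u != 0, P u, x w != 0, ~~ P w & 0 < A w u].
Proof.
move=> x_ge0 chi_x [u xu Pu] [w xw Pw].
have [/existsP[a /existsP[b /and5P[]]]|/existsPn sep] :=
  boolP [exists a, exists b, [&& x a != 0, P a, x b != 0, ~~ P b & 0 < A b a]].
  by exists a, b.
pose x1 := restr P x; pose x2 := restr (predC P) x.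
have Dx : x = x1 + x2.
  by apply/ffunP=> v; rewrite vaddE !ffunE /=; case: (P v); rewrite ?addr0 ?add0r.
have x1_ge0 v : 0 <= x1 v by rewrite ffunE; case: ifP.
have x2_ge0 v : 0 <= x2 v by rewrite ffunE; case: ifP.
have bil12 : bil x1 x2 = 0.
  apply: big1 => v _; rewrite [x2 v]ffunE /=; case: ifP => [Pv|]; last by rewrite mulr0.
  have [->|xv] := eqVneq (x v) 0; first by rewrite mulr0.
  suff -> : dot x1 v = 0 by rewrite mul0r.
  apply: big1 => t _; rewrite ffunE; case: ifP => [Pt|]; last by rewrite mul0r.
  have [->|xt] := eqVneq (x t) 0; first by rewrite mul0r.
  have := existsPn (sep t) v; rewrite xt Pt xv Pv /= => Avt.
  have : 0 <= A t v by rewrite symA; apply: A_ge0; apply: contraNneq Pv => ->.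
  by rewrite symA => Avt_ge0; rewrite (_ : A v t = 0) ?mulr0 //; lia.
have := chi2D x1 x2; rewrite -Dx bil12 mulr0 subr0 => chi12.
have chi1 : 0 <= chi2 x1 by exact: ellA.
have chi2' : 0 <= chi2 x2 by exact: ellA.
have x1_neq0 : x1 != 0.
  by apply: contraNneq xu => /(congr1 (fun f : zvec n => f u)); rewrite !ffunE Pu => ->.
have x2_neq0 : x2 != 0.
  by apply: contraNneq xw => /(congr1 (fun f : zvec n => f w)); rewrite !ffunE /= Pw => ->.
have C1 v : C v <= x1 v by apply: C_le => //; lia.
have C2 v : C v <= x2 v by apply: C_le => //; lia.
have [v Cv] := exists_C_pos; move: (C1 v) (C2 v); rewrite !ffunE /=.
by case: (P v) => /=; lia.
Qed.

(* y stands for the remainder ZK - C_j, so that expo (- y) v = - (C_j, E_v). *)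
Lemma remainder_chi y : (forall u, 0 <= y u) -> (forall u, 0 <= expo (- y) u) ->
  chi2 y <= 0 /\ forall u, y u != 0 -> expo (- y) u = 0.
Proof.
move=> y_ge0 yK; have terms_ge0 u : true -> 0 <= y u * expo (- y) u by rewrite mulr_ge0.
have := chi2_opp (- y); rewrite opprK.
under eq_bigr do rewrite voppE mulNr; rewrite sumrN => chi_y.
have sum_ge0 : 0 <= \sum_v y v * expo (- y) v by exact: sumr_ge0.
split; first by rewrite chi_y oppr_le0.
(* Ellipticity gives [chi2 y >= 0], so this sum of nonnegative terms is also at most 0. *)
have sum_eq0 : \sum_v y v * expo (- y) v = 0.
  by apply/eqP; rewrite eq_le sum_ge0 andbT -oppr_ge0 -chi_y ellA.
move=> u yu; have /eqP : y u * expo (- y) u = 0 by exact: (psumr_eq0P terms_ge0 sum_eq0).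
by rewrite mulf_eq0 (negbTE yu) => /eqP.
Qed.

(* y - y' is Z_min of the support of y. *)
Definition zmin_step y y' := [/\ y != 0, forall v, y v = 0 -> y' v = 0,
  forall v, y v != 0 -> dot (y - y') v <= 0, y - y' != 0 &
  forall Y : zvec n, (forall v, y v = 0 -> Y v = 0) -> (forall v, y v != 0 -> dot Y v <= 0) ->
    Y != 0 -> forall v, (y - y') v <= Y v].

(** On the support of [y], [(y, E_v) = e_v + 2 <= 0], so [y] itself competes with [y - y'] in the
    minimality. The decrease is strict because the support of [y] is connected, which forces
    [y - y'] to be positive on all of it. *)
Lemma zmin_stepP y y' : (forall u, 0 <= y u) -> (forall u, 0 <= expo (- y) u) -> zmin_step y y' ->
  [/\ forall u, 0 <= y' u, forall u, 0 <= expo (- y') u & forall u, y u != 0 -> y' u < y u].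
Proof.
move=> y_ge0 yK [y_neq0 y'_supp ZS Z_neq0 Zmin].
have [chi_y expo_y] := remainder_chi y_ge0 yK.
have dot_y v : y v != 0 -> dot y v = A v v + 2.
  by move/expo_y; rewrite /expo dotN; lia.
pose Z : zvec n := y - y'; have Dy' : y' = y - Z by apply/ffunP=> u; rewrite !vE; ring.
have Z0 v : y v = 0 -> Z v = 0 by move=> yv; rewrite !vE (y'_supp v yv) yv subrr.
have Z_ge0 v : 0 <= Z v.
  apply: (antinef_ge0 A_ge0 negA) => {}v Zv; apply: ZS; apply/eqP=> /Z0 Zv0.
  by rewrite Zv0 in Zv.
have Z_le v : Z v <= y v.
  rewrite /Z; apply: Zmin => // u yu; rewrite dot_y //; have := diagA u; lia.
have y'_ge0 v : 0 <= y' v by move: (Z_le v); rewrite !vE; lia.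
clearbody Z; split=> // u.
  rewrite /expo dotN; have [yu|yu] := eqVneq (y u) 0.
    by have := dot_ge0 A_ge0 y'_ge0 (y'_supp u yu); have := diagA u; lia.
  have := ZS u yu; rewrite Dy' !dotB (dot_y _ yu); lia.
move=> yu; suff : Z u != 0 by have := Z_ge0 u; rewrite Dy' !vE; lia.
apply/eqP=> Zu; have Z_neq0' : Z != 0 by move: Z_neq0; rewrite Dy' opprB addrC subrK.
have [t Zt] := nonzero_entry Z_neq0'.
have yt : y t != 0 by apply/eqP=> /Z0 Zt0; rewrite Zt0 in Zt.
have [|a [b [ya Za yb]]] := supp_connected (P := fun v => Z v != 0) y_ge0 chi_y (ex_intro2 _ _ t yt Zt).
  by exists u; rewrite ?Zu.
rewrite negbK => /eqP Zb Aba; have := ZS b yb.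
have -> : y - y' = Z by apply/ffunP=> v; rewrite Dy' !vE; ring.
apply/negP; rewrite -ltNge /dot (bigD1 a) //= addrC ltr_wpDl //.
  apply: sumr_ge0 => v _; have [->|neq_vb] := eqVneq v b; first by rewrite Zb mul0r.
  by rewrite mulr_ge0 ?Z_ge0 ?A_ge0.
by rewrite mulr_gt0 1?symA // lt_neqAle eq_sym Za Z_ge0.
Qed.

(** * The remainders Z_K - C_j of the NN-elliptic sequence *)

Section Remainders.
Variables (M : nat) (y : nat -> zvec n).
Hypothesis y0K : forall v, 0 <= expo (- y 0%N) v.
Hypothesis y0_min : forall d, (forall v, 0 <= expo d v) -> forall v, (- y 0%N) v <= d v.
Hypothesis yM : y M = 0.
Hypothesis y_step : forall k, (k < M)%N -> zmin_step (y k) (y k.+1).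

Lemma remainderP k : (k <= M)%N -> (forall u, 0 <= y k u) /\ (forall u, 0 <= expo (- y k) u).
Proof.
elim: k => [_|k IHk lt_kM].
  split=> // u; have : (- y 0%N) u <= 0.
    (* The choice [d = 0] stands for [Z_K], which lies in S' because all [e_v <= -2]. *)
    have := @y0_min 0 _ u; rewrite [X in _ <= X]ffunE; apply=> v.
    by rewrite /expo dot0; have := diagA v; lia.
  by rewrite voppE oppr_le0.
have [y_ge0 yK] := IHk (ltnW lt_kM).
by have [] := zmin_stepP y_ge0 yK (y_step lt_kM).
Qed.

Lemma remainder_C k : (k < M)%N ->
  (forall u, C u <= y k u) /\ (forall u, C u != 0 -> expo (- y k) u = 0).
Proof.
move=> lt_kM; have [y_ge0 yK] := remainderP (ltnW lt_kM).
have [chi_y expo_y] := remainder_chi y_ge0 yK; have [y_neq0 _ _ _ _] := y_step lt_kM.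
have C_y := C_le y_ge0 y_neq0 chi_y; split=> // u Cu; apply: expo_y.
by have := C_y u; have := C_ge0 u; lia.
Qed.

(** Each step decreases the remainder strictly on its support, which contains |C|. *)
Lemma remainder_inj j k u : C u != 0 -> (j < M)%N -> (k < M)%N -> y j u = y k u -> j = k.
Proof.
move=> Cu; wlog lt_jk : j k / (j < k)%N => [IH lt_jM lt_kM eq_y|].
  by case: (ltngtP j k) => // lt; [|apply: esym]; apply: IH.
have decr i : (i < M)%N -> y i.+1 u < y i u.
  move=> lt_iM; have [y_ge0 yK] := remainderP (ltnW lt_iM).
  have [_ _] := zmin_stepP y_ge0 yK (y_step lt_iM); apply.
  by have [C_y _] := remainder_C lt_iM; have := C_y u; have := C_ge0 u; lia.
move=> _ lt_kM eq_y; suff : y k u < y j u by rewrite eq_y ltxx.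
elim: k lt_jk lt_kM {eq_y} => // k IHk; rewrite ltnS leq_eqVlt => /predU1P[->|lt_jk] lt_kM.
  by rewrite decr // ltnW.
by apply: lt_trans (IHk lt_jk (ltnW lt_kM)); rewrite decr // ltnW.
Qed.

(** While [- y k <= s], the restriction of [s + y k] to the support of [y k] is anti-nef there. If
    nonzero, it dominates [y k - y k.+1], so [- y k.+1 <= s]; if zero, [s] agrees with [- y k] on
    |C|. Reaching [M] would give [s >= 0]. *)
Lemma antinef_remainderP s : (forall v, 0 <= expo s v) -> ~~ [forall v, (C v != 0) ==> (0 <= s v)] ->
  exists2 j, (j < M)%N & (forall v, (- y j) v <= s v) /\ forall v, C v != 0 -> s v = (- y j) v.
Proof.
move=> sK s_neg.
have : forall k, (k <= M)%N -> (forall v, (- y k) v <= s v) \/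
  exists2 j, (j < M)%N & (forall v, (- y j) v <= s v) /\ forall v, C v != 0 -> s v = (- y j) v.
  elim=> [_|k IHk lt_kM]; first by left; exact: y0_min.
  have [le_ys|] := IHk (ltnW lt_kM); last by right.
  have [y_ge0 yK] := remainderP (ltnW lt_kM); have [_ expo_y] := remainder_chi y_ge0 yK.
  have [_ y'_supp _ _ Zmin] := y_step lt_kM.
  pose x := restr (fun v => y k v != 0) (s + y k).
  have x_le v : x v <= (s + y k) v.
    by rewrite ffunE; case: ifP => // _; have := le_ys v; rewrite !vE; lia.
  have [x0|x_neq0] := eqVneq x 0.
    right; exists k => //; split=> // v Cv; have [C_y _] := remainder_C lt_kM.
    have yv : y k v != 0 by have := C_y v; have := C_ge0 v; lia.
    have : x v = 0 by rewrite x0 ffunE.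
    by rewrite ffunE yv !vE; move: (s v) (y k v); lia.
  left=> v; have [yv|yv] := eqVneq (y k v) 0.
    by have := le_ys v; rewrite !vE yv (y'_supp v yv).
  have : (y k - y k.+1) v <= x v.
    apply: Zmin => // u yu; first by rewrite ffunE yu eqxx.
    have : dot x u <= dot (s + y k) u.
      by apply: ler_dot => //; rewrite [LHS]ffunE yu.
    by have := expo_y u yu; have := sK u; rewrite /expo dotD dotN; lia.
  by rewrite [x v]ffunE yv !vE; move: (s v) (y k v) (y k.+1 v); lia.
move=> /(_ M (leqnn M)) [le_ys|//]; case/negP: s_neg; apply/forallP=> v; apply/implyP=> _.
by have := le_ys v; rewrite yM oppr0 ffunE.
Qed.

(** This decides the reduced coefficient at [s]: in the first case all factors over |C| are 1, in
    the second one of them is 0. *)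
Lemma ext_expo_C d s : is_ext [set v | C v != 0] d s -> ~~ [forall v, (C v != 0) ==> (0 <= d v)] ->
  (exists2 j, (j < M)%N & [forall v, (C v != 0) ==> (d v == (- y j) v)] /\
      forall v, C v != 0 -> expo s v = 0)
  \/ (forall j, (j < M)%N -> ~~ [forall v, (C v != 0) ==> (d v == (- y j) v)]) /\
     (exists2 v, C v != 0 & expo s v < 0).
Proof.
move=> [[s_d sN] s_min] d_neg.
have s_C v : C v != 0 -> s v = d v by move=> Cv; rewrite s_d ?inE.
have s_neg : ~~ [forall v, (C v != 0) ==> (0 <= s v)].
  apply: contra d_neg => /forallP s0; apply/forallP=> v; apply/implyP=> Cv.
  by rewrite -s_C // (implyP (s0 v)).
have [/existsP[v /andP[Cv sv]]|/existsPn sC] := boolP [exists v, (C v != 0) && (expo s v < 0)].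
  right; split; last by exists v.
  move=> j lt_jM; apply/negP=> /forallP d_y; move: sv; apply/negP; rewrite -leNgt.
  have [_ yK] := remainderP (ltnW lt_jM); apply: le_trans (yK v) _.
  have adm_y : adm [set v | C v != 0] d (- y j).
    by split=> u; rewrite inE => Cu; rewrite ?yK // (eqP (implyP (d_y u) Cu)).
  apply: ler_expo => [u _|]; first exact: s_min.
  by rewrite s_C // (eqP (implyP (d_y v) Cv)).
have sK v : 0 <= expo s v.
  by have [Cv|Cv] := boolP (C v != 0); [have := sC v; rewrite Cv -leNgt | rewrite sN ?inE].
left; have [j lt_jM [le_ys eq_ys]] := antinef_remainderP sK s_neg.
exists j => //; split; first by apply/forallP=> v; apply/implyP=> Cv; rewrite -s_C // eq_ys.
have [_ yK] := remainderP (ltnW lt_jM).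
have adm_y : adm [set v | C v != 0] d (- y j).
  by split=> u; rewrite inE => Cu; rewrite ?yK // -s_C // eq_ys.
have -> : s = - y j.
  by apply/ffunP=> v; have := s_min _ adm_y v; have := le_ys v; move: (s v) ((- y j) v); lia.
by have [_] := remainder_C lt_jM.
Qed.

End Remainders.

(** * Elimination of the vertices outside |C| *)

Variable adj : rel 'I_n.
Hypothesis adjC : symmetric adj.
Hypothesis adj_irr : irreflexive adj.
Hypothesis A_adj : forall u v, u != v -> A u v = (adj u v)%:Z.

(** * Subtrees, recognized by counting edges *)

Definition degree T (u : 'I_n) : nat := \sum_(w in T) adj u w.
(** A sum of degrees, hence twice the number of edges inside [T]. *)
Definition edges T : nat := \sum_(u in T) degree T u.

Hypothesis tree_edges : edges [set: 'I_n] = (2 * n.-1)%N.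

Lemma degreeU v T u : v \notin T -> degree (v |: T) u = (adj u v + degree T u)%N.
Proof. by move=> vT; rewrite /degree big_setU1. Qed.

Lemma edgesU v T : v \notin T -> edges (v |: T) = (edges T + 2 * degree T v)%N.
Proof.
move=> vT; rewrite /edges big_setU1 //= degreeU // adj_irr add0n.
under eq_bigr => u _ do rewrite degreeU //.
rewrite big_split /= addnA addnC; congr addn; rewrite mul2n -addnn; congr addn.
by apply: eq_bigr => u _; rewrite adjC.
Qed.

Lemma degree_gt0 T v w : w \in T -> adj v w -> (0 < degree T v)%N.
Proof. by move=> wT vw; rewrite /degree (bigD1 w) //= vw. Qed.

Lemma degree1_inj T v w t : w \in T -> adj v w -> (degree T v <= 1)%N ->
  t \in T -> adj v t -> t = w.
Proof.
move=> wT vw deg1 tT vt; apply/eqP; apply: contraLR deg1 => neq_tw.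
by rewrite -ltnNge /degree (bigD1 w) //= vw (bigD1 t) /= ?vt ?tT.
Qed.

Lemma degreeE T v w : w \in T -> (forall t, t \in T -> adj v t -> t = w) -> adj v w ->
  degree T v = 1%N.
Proof.
move=> wT uniq_w vw; rewrite /degree (bigD1 w) //= vw big1 // => t /andP[tT neq_tw].
by case vt: (adj v t) => //; rewrite (uniq_w t tT vt) eqxx in neq_tw.
Qed.

Lemma adjacent_outside T : T != set0 -> T != setT -> exists v w, [/\ v \notin T, w \in T & adj v w].
Proof.
move=> /set0Pn T0 Tn; have [||u [w [uT wT Awu]]] := connA (P := fun v => v \in T).
- by have [u uT] := T0; exists u.
- apply/existsP; rewrite -negb_forall; apply: contra Tn => /forallP T1.
  by apply/eqP/setP=> v; rewrite inE T1.
exists w, u; split=> //; move: Awu; rewrite A_adj; first by case: adj.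
by apply: contraNneq wT => ->.
Qed.

(** Acyclicity as an edge bound: growing [T] to the whole tree by adjacent vertices adds at least 2
    per step, and the final value is [2 (n - 1)]. *)
Lemma edges_le T : T != set0 -> (edges T + 2 <= 2 * #|T|)%N.
Proof.
move Dk: (n - #|T|)%N => k; elim: k T Dk => [|k IHk] T Dk T0.
  have -> : T = setT.
    by apply/eqP; rewrite -subTset -(geq_leqif (subset_leqif_card _)) ?subsetT // cardsT card_ord; lia.
  rewrite tree_edges cardsT card_ord; have : (0 < #|T|)%N by rewrite card_gt0.
  by have := max_card T; rewrite card_ord; lia.
have [|v [w [vT wT vw]]] := adjacent_outside T0.
  by apply/eqP=> TT; rewrite TT cardsT card_ord subnn in Dk.
have deg_gt0 := degree_gt0 wT vw.
have : (edges (v |: T) + 2 <= 2 * #|v |: T|)%N.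
  by apply: IHk; [rewrite cardsU1 vT; lia | apply/set0Pn; exists v; rewrite setU11].
by rewrite cardsU1 vT edgesU //; move: (edges T) (degree T v) deg_gt0; lia.
Qed.

(** Equality in [edges_le]; inside a tree this means that [T] induces a connected subgraph. *)
Definition subtree T := (T != set0) && (2 * #|T| <= edges T + 2)%N.

(** A second neighbour of [v] in [T] would push [v |: T] beyond the bound of [edges_le]. *)
Lemma subtreeU T v w : subtree T -> v \notin T -> w \in T -> adj v w ->
  subtree (v |: T) /\ (degree T v <= 1)%N.
Proof.
case/andP=> T0 leT vT wT vw; have vT0 : v |: T != set0 by apply/set0Pn; exists v; rewrite setU11.
have := edges_le vT0; have := degree_gt0 wT vw.
rewrite /subtree vT0 cardsU1 vT edgesU //=.
by move: (edges T) (degree T v) #|T| leT => a b c; split; lia.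
Qed.

Definition suppC : {set 'I_n} := [set v | C v != 0].

(** A maximal subtree inside |C| is all of it: otherwise [supp_connected] supplies an adjacent
    vertex of |C| to add. *)
Lemma subtree_suppC : subtree suppC.
Proof.
have [c Cc] := exists_C_pos.
have [|S /maxsetP[/andP[S_C treeS] S_max] _] :=
  @maxset_exists _ [pred S : {set 'I_n} | (S \subset suppC) && subtree S] [set c].
  rewrite /= sub1set inE gt_eqF //= /subtree cards1 addn2 andbT.
  by apply/set0Pn; exists c; rewrite set11.
have [<- //|neq_SC] := eqVneq S suppC.
have [p pS] : exists p, p \in S by apply/set0Pn; case/andP: treeS.
have [w wC wS] : exists2 w, w \in suppC & w \notin S.
  by apply/subsetPn; apply: contra neq_SC => CS; rewrite eqEsubset S_C.
have [|||a [b [_ aS Cb bS Aba]]] := @supp_connected C (fun v => v \in S) C_ge0.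
- by rewrite chi2C.
- by exists p => //; have := subsetP S_C p pS; rewrite inE.
- by exists w => //; rewrite inE in wC.
have ba : adj b a.
  by move: Aba; rewrite A_adj; [case: adj | apply: contraNneq bS => ->].
have [treeU _] := subtreeU treeS bS aS ba.
have := S_max (b |: S); rewrite /= treeU subUset sub1set inE Cb S_C subsetUr => /(_ isT isT) eqS.
by rewrite -eqS setU11 in bS.
Qed.

(* S is the branch hanging at v once v is attached to T. *)
Lemma branch_exists T : subtree T -> T != setT -> exists v w (S : {set 'I_n}),
  [/\ [/\ v \notin T, w \in T & adj v w], subtree (v |: T),
      [/\ v \in S, [disjoint S & T] &
         forall u t, u \in S -> t \in T -> adj u t -> u = v /\ t = w]
    & forall u t, u \in S -> adj u t -> (t \in S) || (t \in T)].
Proof.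
move=> treeT T_neq; have [v [w [vT wT vw]]] := adjacent_outside (proj1 (andP treeT)) T_neq.
have [treeU deg1] := subtreeU treeT vT wT vw.
pose P := [pred S : {set 'I_n} | [&& v \in S, [disjoint S & T], subtree (S :|: T) &
  [forall u in S, forall t in T, adj u t ==> (u == v) && (t == w)]]].
have [|S /maxsetP[/and4P[vS dST treeS /forall_inP sepS] S_max] _] := @maxset_exists _ P [set v].
  rewrite /= set11 treeU disjoints1 vT /=; apply/forall_inP=> u /set1P->; apply/forall_inP=> t tT.
  by apply/implyP=> vt; rewrite eqxx (degree1_inj wT vw deg1 tT vt) eqxx.
have sep u t : u \in S -> t \in T -> adj u t -> u = v /\ t = w.
  move=> uS tT ut; have /forall_inP/(_ t tT) := sepS u uS.
  by rewrite ut => /andP[/eqP-> /eqP->].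
exists v, w, S; split=> // t u tS tu; apply: contraT; rewrite negb_or => /andP[uS uT].
have uST : u \notin S :|: T by rewrite inE negb_or uS.
have tST : t \in S :|: T by rewrite inE tS.
(* A neighbour [u] of the branch outside [S] and [T] has [t] as its only neighbour in their union,
   so it could be added to the maximal [S]. *)
have [treeSu deg_u] := subtreeU treeS uST tST (etrans (adjC u t) tu).
have PuS : P (u |: S).
  rewrite /= setU1r // -setUA treeSu disjoints_subset subUset sub1set inE uT.
  rewrite -disjoints_subset dST /=.
  apply/forall_inP=> a /setU1P[->|aS]; last exact: sepS.
  apply/forall_inP=> b bT; apply/implyP=> ub.
  have eq_bt : b = t.
    by apply: (degree1_inj tST _ deg_u) => //; [rewrite adjC | rewrite inE bT orbT].
  by have /disjointFr := dST => /(_ t tS); rewrite -eq_bt bT.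
by have := S_max _ PuS (subsetUr _ _) => eqS; rewrite -eqS setU11 in uS.
Qed.

(** * Taylor coefficients and sums over fibres *)

Definition cpowz (a z : int) : int := if z is Posz k then cpow a k else 0.

Lemma cpow0 a : cpow a 0 = 1.
Proof. by case: a => p; rewrite /= ?expr0 ?bin0. Qed.

(** Pascal's rule, from [(1 - x)^a = (1 - x) (1 - x)^(a - 1)]. *)
Lemma cpowS a k : cpow (a - 1) k.+1 = cpow a k.+1 + cpow (a - 1) k.
Proof.
case: a => [[|p]|p].
- have -> : Posz 0 - 1 = Negz 0 by [].
  by rewrite /= !add0n !binn bin0n mulr0 add0r.
- have -> : Posz p.+1 - 1 = Posz p by lia.
  by rewrite /= binS PoszD exprS; ring.
have -> : Negz p - 1 = Negz p.+1 by lia.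
by rewrite /= !addSn addnS binS PoszD.
Qed.

Lemma sum_cpow a k : \sum_(i < k.+1) cpow a (k - i) = cpow (a - 1) k.
Proof.
elim: k => [|k IHk]; first by rewrite big_ord1 subnn !cpow0.
rewrite big_ord_recl subn0 cpowS; congr (_ + _); rewrite -IHk.
by apply: eq_bigr => i _; rewrite lift0 subSS.
Qed.

(** A sum over a possibly infinite set on which [F] has finite support: a finite list carries all
    nonzero terms. *)
Definition fibsum (P : pred (zvec n)) (F : zvec n -> int) (c : int) :=
  exists s : seq (zvec n), [/\ uniq s, {in s, forall d, P d},
    forall d, P d -> F d != 0 -> d \in s & \sum_(d <- s) F d = c].

Definition fibre T d : pred (zvec n) := fun x => [forall u in T, x u == d u].

(* The coefficient of Z reduced to T: valencies are taken inside T. *)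
Definition redz T y : int := \prod_(v in T) cpowz ((degree T v)%:Z - 2) (expo y v).

Lemma fibreP T d x : reflect (forall u, u \in T -> x u = d u) (fibre T d x).
Proof. by apply: (iffP forall_inP) => eqxd u uT; apply/eqP/eqxd. Qed.

Lemma redz_ge0 T y v : redz T y != 0 -> v \in T -> 0 <= expo y v.
Proof.
move=> y_neq0 vT; rewrite leNgt; apply: contra y_neq0 => yv.
by rewrite /redz (bigD1 v) //=; case: (expo y v) yv => // k _; rewrite mul0r.
Qed.

Section Elimination.
Variables (T S : {set 'I_n}) (v w : 'I_n) (d s : zvec n).
Hypothesis vT : v \notin T.
Hypothesis wT : w \in T.
Hypothesis vw : adj v w.
Hypothesis vS : v \in S.
Hypothesis dST : [disjoint S & T].
Hypothesis sepS : forall u t, u \in S -> t \in T -> adj u t -> u = v /\ t = w.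
Hypothesis closedS : forall u t, u \in S -> adj u t -> (t \in S) || (t \in T).
Hypothesis suppC_T : suppC \subset T.
Hypothesis ext_s : is_ext T d s.

(* The coordinate at v starts from its least admissible value s v. *)
Definition shifted (i : nat) : zvec n := [ffun u => if u == v then s v + i%:Z else d u].

Let neq_wv : w != v. Proof. by apply: contraNneq vT => <-. Qed.

Let TS u : u \in T -> u \notin S.
Proof. by move=> uT; rewrite (disjointFl dST). Qed.

Let shifted_T i u : u \in T -> shifted i u = d u.
Proof. by move=> uT; rewrite ffunE ifN //; apply: contraNneq vT => <-. Qed.

Let shifted_v i : shifted i v = s v + i%:Z. Proof. by rewrite ffunE eqxx. Qed.

(** For [i = 0] the extension lies below [s] and equals it at [v], so its exponent at [v] is at
    least that of [s]; [expo_ext_mono] carries nonnegativity to larger [i]. *)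
Lemma shifted_adm i y : is_ext (v |: T) (shifted i) y -> adm T d y.
Proof.
have yv_ge0 : forall y, is_ext (v |: T) (shifted i) y -> 0 <= expo y v.
  elim: i => [|i IHi] {}y ext_y.
    have [[sT sN] s_min] := ext_s; have [[yT yN] y_min] := ext_y.
    apply: le_trans (sN v vT) (ler_expo _ _) => [u _|]; last by rewrite yT ?setU11 // shifted_v addr0.
    apply: y_min; split=> t; rewrite in_setU1.
      by case/predU1P=> [->|tT]; rewrite ?shifted_v ?addr0 // shifted_T ?sT.
    by rewrite negb_or => /andP[_ tT]; exact: sN.
  have [z ext_z] := ext_exists (v |: T) (shifted i).
  apply: le_trans (IHi z ext_z) _.
  apply: (expo_ext_mono vT wT _ _ _ _ ext_z ext_y).
  - by rewrite A_adj 1?eq_sym // vw.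
  - move=> u uT; apply/eqP; apply: contraNT uT => Cu.
    by apply: (subsetP suppC_T); rewrite inE.
  - by move=> u uT; rewrite !shifted_T.
  by rewrite !shifted_v -addrA -PoszD addn1.
move=> ext_y; have [[yT yN] _] := ext_y; split=> u uT.
  by rewrite yT ?shifted_T // setU1r.
have [->|neq_uv] := eqVneq u v; first exact: yv_ge0.
by rewrite yN // in_setU1 negb_or neq_uv.
Qed.

(** Replacing [y] by [s] off the branch [S] keeps it admissible, since vertices outside [S] and [T]
    have no neighbour in [S]; minimality of [y] concludes. *)
Lemma shifted_outside i y u : is_ext (v |: T) (shifted i) y -> u \notin S -> y u = s u.
Proof.
move=> ext_y; have [[sT sN] s_min] := ext_s; have [[yT yN] y_min] := ext_y.
have le_sy t : s t <= y t by apply: s_min; exact: shifted_adm ext_y.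
pose z : zvec n := [ffun t => if t \in S then y t else s t].
have le_zy t : z t <= y t by rewrite ffunE; case: ifP.
suff adm_z : adm (v |: T) (shifted i) z.
  move=> uS; apply: le_anti; rewrite le_sy andbT.
  by have := y_min _ adm_z u; rewrite [z u]ffunE (negbTE uS).
split=> t; rewrite in_setU1.
  case/predU1P=> [->|tT]; first by rewrite ffunE vS yT ?setU11.
  by rewrite ffunE (negbTE (TS tT)) sT ?shifted_T.
move=> tvT; have [tS|tS] := boolP (t \in S).
  apply: le_trans (yN t _) (ler_expo _ _) => //; first by rewrite in_setU1.
  by rewrite ffunE tS.
move: tvT; rewrite negb_or => /andP[_ tT].
apply: le_trans (sN t tT) _; rewrite /expo; suff -> : dot z t = dot s t by [].
apply: eq_bigr => a _; rewrite ffunE; case: ifP => // aS.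
have neq_at : a != t by apply: contraNneq tS => <-.
rewrite A_adj //; case at_: (adj a t); last by rewrite !mulr0.
by have := closedS aS at_; rewrite (negbTE tS) (negbTE tT).
Qed.

(** The edge from [v] to [w] is the only one between the branch and [T], so the shift is felt in [T]
    at [w] alone. *)
Lemma shifted_expo i y u : is_ext (v |: T) (shifted i) y -> u \in T ->
  expo y u = expo s u - (if u == w then i%:Z else 0).
Proof.
move=> ext_y uT; suff : dot y u = dot s u + (if u == w then i%:Z else 0).
  by rewrite /expo => ->; move: (dot s u) (if _ then _ else _) => p q; ring.
have yv : y v = s v + i%:Z by have [[yT _] _] := ext_y; rewrite yT ?setU11.
have neq_uv : u != v by apply: contraNneq vT => <-.
have eq_v : i%:Z * A v u = (if u == w then i%:Z else 0).
  rewrite A_adj 1?eq_sym //; have [->|neq_uw] := eqVneq u w; first by rewrite vw mulr1.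
  case vu: (adj v u); last by rewrite mulr0.
  by have [_ eq_uw] := sepS vS uT vu; rewrite eq_uw eqxx in neq_uw.
have eq_rest : \sum_(t | t != v) y t * A t u = \sum_(t | t != v) s t * A t u.
  apply: eq_bigr => t neq_tv; have [tS|tS] := boolP (t \in S); last first.
    by rewrite (shifted_outside ext_y tS).
  have neq_tu : t != u by apply: contraNneq (TS uT) => <-.
  rewrite A_adj //; case tu: (adj t u); last by rewrite !mulr0.
  by have [eq_tv _] := sepS tS uT tu; rewrite eq_tv eqxx in neq_tv.
by rewrite /dot (bigD1 v) //= [in RHS](bigD1 v) //= eq_rest yv mulrDl eq_v addrAC.
Qed.

Definition restz : int := \prod_(u in T | u != w) cpowz ((degree T u)%:Z - 2) (expo s u).

(** The leaf [v] has valency 1, so its factor is [1 / (1 - x)] with all coefficients 1; attaching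
    [v] raises the valency of [w] by one. *)
Lemma redz_shifted i y : is_ext (v |: T) (shifted i) y ->
  redz (v |: T) y = cpowz ((degree T w)%:Z - 1) (expo s w - i%:Z) * restz.
Proof.
move=> ext_y; rewrite /redz big_setU1 //=.
have uniq_w t : t \in T -> adj v t -> t = w by move=> tT vt; have [_] := sepS vS tT vt.
have -> : cpowz ((degree (v |: T) v)%:Z - 2) (expo y v) = 1.
  rewrite degreeU // adj_irr add0n (degreeE wT uniq_w vw).
  have : 0 <= expo y v by have [_] := shifted_adm ext_y; apply.
  by case: (expo y v) => // k _; rewrite /= add0n binn.
rewrite mul1r (bigD1 w) //= (shifted_expo ext_y wT) eqxx; congr (_ * _).
  by rewrite degreeU // adjC vw; congr cpowz; rewrite PoszD; ring.
apply: eq_bigr => u /andP[uT neq_uw]; rewrite (shifted_expo ext_y uT) (negbTE neq_uw) subr0.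
rewrite degreeU // adjC; case vu: (adj v u) => //.
by rewrite (uniq_w u uT vu) eqxx in neq_uw.
Qed.

(* The sum over the coordinate at the leaf v is a partial sum of the coefficients of the factor
   at w, so it divides that factor by 1 - x: the valency of w drops by one. *)
Lemma eliminate F :
    (forall x, fibre T d x -> F x != 0 -> forall u, 0 <= expo x u) ->
    (forall d' y, is_ext (v |: T) d' y -> fibsum (fibre (v |: T) d') F (redz (v |: T) y)) ->
  fibsum (fibre T d) F (redz T s).
Proof.
move=> F_ge0 F_vT; pose a := (degree T w)%:Z - 1.
have redz_s : redz T s = cpowz (a - 1) (expo s w) * restz.
  rewrite /redz (bigD1 w) //=; congr (cpowz _ _ * _); rewrite /a; ring.
(* Such an [x] is admissible, hence above [s]; each unit of [x v - s v] uses up one unit of the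
   exponent at [w], so finitely many layers matter. *)
have bounds x : fibre T d x -> F x != 0 -> s v <= x v /\ x v - s v <= expo s w.
  move=> x_fib Fx; have xK := F_ge0 x x_fib Fx; have x_T := fibreP _ _ _ x_fib.
  have [[sT sN] s_min] := ext_s; have le_sx u : s u <= x u by apply: s_min; split.
  split=> //; suff : dot s w + (x v - s v) <= dot x w.
    by have := xK w; rewrite /expo; move: (dot x w) (dot s w) (x v) (s v) (A w w); clear; lia.
  have le_rest : \sum_(u | u != v) s u * A u w <= \sum_(u | u != v) x u * A u w.
    apply: ler_sum => u neq_uv; have [->|neq_uw] := eqVneq u w; first by rewrite x_T // sT.
    by rewrite ler_wpM2r ?A_ge0.
  rewrite /dot (bigD1 v) //= [leRHS](bigD1 v) //= A_adj 1?eq_sym // vw !mulr1.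
  by rewrite addrAC [s v + _]addrC subrK lerD2l.
have partial N : fibsum (fun x => fibre T d x && (s v <= x v < s v + N%:Z)) F
    (\sum_(i < N) cpowz a (expo s w - i%:Z) * restz).
  elim: N => [|N [l [uniq_l l_fib l_all sum_l]]].
    exists [::]; split=> //; rewrite ?big_nil ?big_ord0 //.
    by move=> x /andP[_]; rewrite addr0 => /andP[/le_lt_trans lt_s /lt_s]; rewrite ltxx.
  have [y ext_y] := ext_exists (v |: T) (shifted N).
  have [l' [uniq_l' l'_fib l'_all sum_l']] := F_vT _ _ ext_y.
  have l'P x : x \in l' -> fibre T d x /\ x v = s v + N%:Z.
    move=> /l'_fib/fibreP x_fib; split; last by rewrite x_fib ?setU11 ?shifted_v.
    by apply/fibreP=> u uT; rewrite x_fib ?setU1r ?shifted_T.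
  exists (l ++ l'); split.
  - rewrite cat_uniq uniq_l uniq_l' andbT /=; apply/hasPn=> x /l'P[_ xv].
    by apply/negP=> /l_fib/andP[_]; rewrite xv ltxx andbF.
  - move=> x; rewrite mem_cat => /orP[/l_fib/andP[-> /=]|/l'P[-> -> /=]].
      by move: (x v) (s v); clear; lia.
    by move: (s v); clear; lia.
  - move=> x /andP[x_fib x_v] Fx; rewrite mem_cat.
    have [lt_xN|ge_xN] := ltP (x v) (s v + N%:Z).
      by rewrite l_all ?x_fib //= lt_xN andbT; case/andP: x_v.
    rewrite (l'_all x) ?orbT //; apply/fibreP=> u; rewrite in_setU1.
    case/predU1P=> [->|uT]; first by rewrite shifted_v; move: (x v) (s v) x_v ge_xN; clear; lia.
    by rewrite shifted_T //; apply: (fibreP _ _ _ x_fib).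
  by rewrite big_cat /= sum_l sum_l' (redz_shifted ext_y) big_ord_recr.
case Dk: (expo s w) => [k|k]; last first.
  exists [::]; split=> //; last by rewrite big_nil redz_s Dk mul0r.
  by move=> x x_fib Fx; have := bounds x x_fib Fx; rewrite Dk; move: (x v) (s v); clear; lia.
have [l [uniq_l l_fib l_all sum_l]] := partial k.+1; exists l; split=> //.
- by move=> x /l_fib/andP[].
- move=> x x_fib Fx; apply: l_all => //; rewrite x_fib /=.
  by have := bounds x x_fib Fx; rewrite Dk; move: (x v) (s v); clear; lia.
rewrite sum_l redz_s Dk -mulr_suml; congr (_ * _).
rewrite /= -sum_cpow; apply: eq_bigr => i _.
by rewrite subzn // -ltnS ltn_ord.
Qed.

End Elimination.

(** Induction on the number of vertices outside [T]; when there are none, the fibre is the single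
    point [s]. *)
Lemma fibre_sum T d s : subtree T -> suppC \subset T -> is_ext T d s ->
  fibsum (fibre T d) (redz setT) (redz T s).
Proof.
move Dk: (n - #|T|)%N => k; elim: k T Dk d s => [|k IHk] T Dk d s treeT C_T ext_s.
  have TT : T = setT.
    by apply/eqP; rewrite -subTset -(geq_leqif (subset_leqif_card _)) ?subsetT // cardsT card_ord; lia.
  move: ext_s; rewrite TT => -[[sT _] _]; exists [:: s]; split=> //; last by rewrite big_seq1.
    by move=> x; rewrite inE => /eqP->; apply/fibreP=> u uT; exact: sT.
  move=> x /fibreP x_fib _; rewrite inE; apply/eqP/ffunP=> u; rewrite sT ?x_fib //.
have T_neq : T != setT.
  by apply/eqP=> TT; rewrite TT cardsT card_ord subnn in Dk.
have [v [w [S [[vT wT vw] treeU [vS dST sepS] closedS]]]] := branch_exists treeT T_neq.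
apply: (eliminate vT wT vw vS dST sepS closedS C_T ext_s).
  by move=> x _ Fx u; apply: (redz_ge0 Fx).
move=> d' y; apply: IHk => //; first by rewrite cardsU1 vT; move: Dk; clear; lia.
by apply: subset_trans C_T _; exact: subsetUr.
Qed.

(** If [d >= 0] on |C|, the truncation removes every nonzero term. Otherwise it removes none, and
    the sum is the single coefficient settled by [ext_expo_C]. *)
Lemma fibre_truncated_sum M (y : nat -> zvec n) d :
    (forall v, 0 <= expo (- y 0%N) v) ->
    (forall x, (forall v, 0 <= expo x v) -> forall v, (- y 0%N) v <= x v) ->
    y M = 0 -> (forall k, (k < M)%N -> zmin_step (y k) (y k.+1)) ->
  fibsum (fibre suppC d) (fun x => if [forall u, 0 <= x u] then 0 else redz setT x)
    (#|[set k : 'I_M | [forall v in suppC, d v == (- y k) v]]|)%:Z.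
Proof.
move=> y0K y0_min yM y_step.
have suppCE (P : pred 'I_n) : [forall v in suppC, P v] = [forall v, (C v != 0) ==> P v].
  by apply: eq_forallb => v; rewrite inE.
have [d_ge0|d_neg] := boolP [forall v, (C v != 0) ==> (0 <= d v)].
  rewrite (_ : [set k | _] = set0) ?cards0.
    exists [::]; split=> //; last by rewrite big_nil.
    move=> x x_fib; case: ifPn => // /negP x_neg Fx; case: x_neg.
    apply/forallP; apply: expo_ge0_nonneg => v; first by apply: (redz_ge0 Fx).
    by move=> Cv; rewrite (fibreP _ _ _ x_fib) ?inE // (implyP (forallP d_ge0 v)).
  apply/setP=> k; rewrite !inE suppCE; apply/negP=> /forallP d_y.
  have [c Cc] := exists_C_pos; have := remainder_C y0K y0_min y_step (ltn_ord k).
  have Cc0 : C c != 0 by rewrite gt_eqF.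
  move=> [/(_ c) C_y _]; have /eqP d_c := implyP (d_y c) Cc0.
  have := implyP (forallP d_ge0 c) Cc0; rewrite d_c voppE.
  by move: (C c) (y k c) Cc C_y; clear; lia.
have [s ext_s] := ext_exists suppC d.
have [l [uniq_l l_fib l_all sum_l]] := fibre_sum subtree_suppC (subxx _) ext_s.
have trunc_fib x : fibre suppC d x -> [forall u, 0 <= x u] = false.
  move=> x_fib; apply/negP=> /forallP x_ge0; case/negP: d_neg; apply/forallP=> v.
  by apply/implyP=> Cv; rewrite -(fibreP _ _ _ x_fib) ?inE.
exists l; split=> //; first by move=> x x_fib; rewrite trunc_fib //; exact: l_all.
rewrite big_seq (eq_bigr (redz setT)) => [|x /l_fib/trunc_fib-> //].
rewrite -big_seq sum_l.
have [[j lt_jM [d_y expo_s]]|[d_ny [v Cv sv]]] := ext_expo_C y0K y0_min yM y_step ext_s d_neg.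
  rewrite /redz big1 => [|v]; last by rewrite inE => /expo_s ->; rewrite /= cpow0.
  rewrite (_ : [set k | _] = [set Ordinal lt_jM]) ?cards1 //; apply/setP=> k; rewrite !inE suppCE.
  apply/idP/eqP=> [d_yk|->]; last by [].
  have [c Cc] := exists_C_pos; have Cc0 : C c != 0 by rewrite gt_eqF.
  apply/val_inj/(remainder_inj y0K y0_min y_step Cc0 (ltn_ord k) lt_jM).
  have /eqP := implyP (forallP d_yk c) Cc0; have /eqP-> := implyP (forallP d_y c) Cc0.
  by rewrite !voppE => /oppr_inj.
rewrite (_ : [set k | _] = set0) ?cards0; last first.
  by apply/setP=> k; rewrite !inE suppCE; apply/negbTE/d_ny.
rewrite /redz (bigD1 v) ?inE //=; case: (expo s v) sv => // k _.
by rewrite mul0r.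
Qed.

End EllipticLattice.

(** * Passage from rational to integral coordinates *)

Section Translation.
Variables (n : nat) (e : 'I_n -> int) (adj : rel 'I_n).
Hypothesis adjC : symmetric adj.
Hypothesis negI : neg_definite e adj.

Definition imx (u w : 'I_n) : int := if u == w then e u else (adj u w)%:Z.

Lemma ImxE u w : Imx e adj u w = (imx u w)%:~R.
Proof. by rewrite mxE /imx; case: eqP => // _; case: adj. Qed.

Lemma imxC u w : imx u w = imx w u.
Proof. by rewrite /imx eq_sym adjC; case: eqP => // ->. Qed.

Lemma imx_ge0 u w : u != w -> 0 <= imx u w.
Proof. by rewrite /imx => /negbTE->. Qed.

Lemma imx_diag v : imx v v = e v. Proof. by rewrite /imx eqxx. Qed.

Local Notation Q := (fun u w => Imx e adj u w).

Lemma form_bil (x y : qvec n) : Defs.form e adj x y = bil Q x y.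
Proof.
rewrite /Defs.form /bil /dot exchange_big; apply: eq_bigr => w _; rewrite mulr_suml.
by apply: eq_bigr.
Qed.

Lemma form_Ebas (x : qvec n) v : Defs.form e adj x (Ebas v) = dot Q x v.
Proof.
rewrite form_bil -bil_unitv; congr (bil _ _ _); apply/ffunP=> u; rewrite !ffunE.
by case: eqP.
Qed.

Lemma dot_zq (l : zvec n) v : dot Q (zq l) v = (dot imx l v)%:~R.
Proof.
rewrite /dot rmorph_sum; apply: eq_bigr => u _.
by rewrite ffunE ImxE rmorphM.
Qed.

Lemma bil_zq (k l : zvec n) : bil Q (zq k) (zq l) = (bil imx k l)%:~R.
Proof. by rewrite /bil rmorph_sum; apply: eq_bigr => u _; rewrite dot_zq ffunE rmorphM. Qed.

Lemma zqD (k l : zvec n) : zq (k + l) = zq k + zq l.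
Proof. by apply/ffunP=> u; rewrite !ffunE rmorphD. Qed.

Lemma zqN (l : zvec n) : zq (- l) = - zq l.
Proof. by apply/ffunP=> u; rewrite !ffunE rmorphN. Qed.

Lemma zq_inj : injective (@zq n).
Proof.
by move=> k l /ffunP eq_kl; apply/ffunP=> u; have := eq_kl u; rewrite !ffunE => /intr_inj.
Qed.

Lemma zq0 : zq 0 = 0 :> qvec n.
Proof. by apply/ffunP=> u; rewrite !ffunE. Qed.

Lemma zq_eq0 (l : zvec n) : (zq l == 0) = (l == 0).
Proof. by rewrite -zq0; apply/eqP/eqP=> [/zq_inj|->]. Qed.

Lemma bil_lt0 (x : qvec n) : x != 0 -> bil Q x x < 0.
Proof. by rewrite -form_bil; exact: negI. Qed.

Lemma imx_lt0 (x : zvec n) : x != 0 -> bil imx x x < 0.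
Proof. by rewrite -zq_eq0 => /bil_lt0; rewrite bil_zq ltrz0. Qed.

Lemma dot_eq0 (x : qvec n) : (forall v, dot Q x v = 0) -> x = 0.
Proof.
move=> x0; apply/eqP/negPn/negP=> /bil_lt0; rewrite /bil big1 ?ltxx // => v _.
by rewrite x0 mul0r.
Qed.

Lemma dot_inj (x y : qvec n) : (forall v, dot Q x v = dot Q y v) -> x = y.
Proof.
by move=> eq_xy; apply/eqP; rewrite -subr_eq0; apply/eqP/dot_eq0 => v; rewrite dotB eq_xy subrr.
Qed.

Lemma dot_mulmx (x : qvec n) v : dot Q x v = ((\row_u x u) *m Imx e adj) 0 v.
Proof. by rewrite mxE /dot; apply: eq_bigr => u _; congr (_ * _); rewrite mxE. Qed.

Lemma Imx_unit : Imx e adj \in unitmx.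
Proof.
rewrite -row_free_unit -kermx_eq0; apply/eqP/row_matrixP => i; rewrite row0.
pose x : qvec n := [ffun u => kermx (Imx e adj) i u].
have x0 : x = 0.
  apply: dot_eq0 => v; rewrite dot_mulmx.
  have -> : \row_u x u = row i (kermx (Imx e adj)) by apply/rowP=> u; rewrite [LHS]mxE ffunE [RHS]mxE.
  by rewrite -row_mul mulmx_ker !mxE.
by apply/rowP=> u; have /ffunP/(_ u) := x0; rewrite !ffunE => k_iu; rewrite [LHS]mxE [RHS]mxE.
Qed.

Lemma dot_Estar v w : dot Q (Estar e adj v) w = - (v == w)%:R.
Proof.
rewrite /dot; under eq_bigr do rewrite ffunE mulNr; rewrite sumrN; congr (- _).
by have /matrixP/(_ v w) := mulVmx Imx_unit; rewrite !mxE.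
Qed.

Lemma dot_ZK w : dot Q (ZK e adj) w = (e w + 2)%:~R.
Proof.
rewrite /dot; under eq_bigr do rewrite ffunE mulr_suml.
rewrite exchange_big /=; under eq_bigr do under eq_bigr do rewrite -mulrA.
under eq_bigr do rewrite -mulr_sumr.
have sum_inv v : \sum_u invmx (Imx e adj) v u * Imx e adj u w = (v == w)%:R.
  by have /matrixP/(_ v w) := mulVmx Imx_unit; rewrite !mxE.
rewrite (bigD1 w) //= sum_inv eqxx mulr1 big1 ?addr0 ?rmorphD // => v neq_vw.
by rewrite sum_inv (negbTE neq_vw) mulr0.
Qed.

Lemma ImxC u w : Imx e adj u w = Imx e adj w u.
Proof. by rewrite !ImxE imxC. Qed.

Lemma Imx_ge0 u w : u != w -> 0 <= Imx e adj u w.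
Proof. by move=> neq_uw; rewrite ImxE ler0z imx_ge0. Qed.

Lemma chi_zq (l : zvec n) : chi e adj (zq l) = (chi2 imx l)%:~R / 2.
Proof.
rewrite /chi form_bil bilDr; congr (_ / _).
have -> : bil Q (zq l) (- ZK e adj) = - \sum_v (l v * (imx v v + 2))%:~R.
  rewrite bilC; last exact: ImxC.
  rewrite bilNl; congr (- _); apply: eq_bigr => v _.
  by rewrite dot_ZK ffunE imx_diag rmorphM mulrC.
by rewrite bil_zq -rmorph_sum -rmorphB -rmorphN opprB.
Qed.

Lemma Estar_ge0 v u : 0 <= Estar e adj v u.
Proof.
apply: (antinef_ge0 Imx_ge0 bil_lt0) => w _.
by rewrite dot_Estar oppr_le0 ler0n.
Qed.

Lemma Estar_gt0 v : 0 < Estar e adj v v.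
Proof.
rewrite lt_neqAle Estar_ge0 andbT eq_sym; apply/eqP=> Ev.
have := dot_ge0 Imx_ge0 (Estar_ge0 v) Ev.
by rewrite dot_Estar eqxx.
Qed.

(** Cramer's rule: a signed multiple of [(1, ..., 1)] times the adjugate pairs with every [E_v] to
    [- |det I|]. *)
Lemma exists_ample : exists D : zvec n, forall v, dot imx D v < 0.
Proof.
pose I : 'M[int]_n := \matrix_(u, w) imx u w.
have det_neq0 : \det I != 0.
  have : \det (map_mx (intr : int -> rat) I) != 0.
    have -> : map_mx (intr : int -> rat) I = Imx e adj.
      by apply/matrixP=> u w; rewrite ImxE !mxE.
    by have := Imx_unit; rewrite unitmxE unitfE.
  by rewrite det_map_mx intr_eq0.
pose r : 'rV[int]_n := const_mx 1 *m \adj I.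
exists [ffun u => - (Num.sg (\det I) * r 0 u)] => v.
have -> : dot imx [ffun u => - (Num.sg (\det I) * r 0 u)] v = - (Num.sg (\det I) * (r *m I) 0 v).
  rewrite mxE mulr_sumr -sumrN; apply: eq_bigr => u _.
  by rewrite ffunE [I u v]mxE mulNr mulrA.
rewrite /r -mulmxA mul_adj_mx mul_mx_scalar !mxE mulr1 oppr_lt0 -normrEsg normr_gt0.
exact: det_neq0.
Qed.

Lemma imx_connected : (forall u w, connect adj u w) ->
  forall P : pred 'I_n, (exists u, P u) -> (exists u, ~~ P u) ->
  exists u w, [/\ P u, ~~ P w & 0 < imx w u].
Proof.
move=> conn P [u0 Pu0] [w0 Pw0].
have [/existsP[u /existsP[w /and3P[Pu Pw uw]]]|/existsPn none] :=
  boolP [exists u, exists w, [&& P u, ~~ P w & adj u w]].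
  exists u, w; split=> //; rewrite imxC /imx uw.
  by case: eqP => // eq_uw; rewrite -eq_uw Pu in Pw.
have sep u w : adj u w -> P u -> P w.
  by move=> uw Pu; have := existsPn (none u) w; rewrite Pu uw andbT /= negbK.
have closedP : closed adj P.
  by move=> u w uw; apply/idP/idP; apply: sep; rewrite // adjC.
by have := closed_connect closedP (conn u0 w0); rewrite !unfold_in Pu0 (negbTE Pw0).
Qed.

Local Notation expo := (expo imx).

Lemma dot_expo (d : zvec n) v : dot Q (ZK e adj + zq d) v = (- expo d v)%:~R.
Proof.
by rewrite dotD dot_ZK dot_zq -rmorphD /expo imx_diag; congr _%:~R; ring.
Qed.

(** Pairing with the [E_v] leaves [k_v = - (Z_K + d, E_v)] as the only possible exponent vector, so
    the sum has at most one term. *)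
Lemma zcoefE (d : zvec n) :
  zcoef e adj (ZK e adj + zq d) = \prod_v cpowz ((valency adj v)%:Z - 2) (expo d v).
Proof.
rewrite /zcoef; set l := ZK e adj + zq d; set N := zbound e adj l.
have cond (k : {ffun 'I_n -> 'I_N}) :
    [forall u, \sum_v (k v : nat)%:R * Estar e adj v u == l u] = [forall v, (k v : nat)%:Z == expo d v].
  pose x : qvec n := [ffun u => \sum_v (k v : nat)%:R * Estar e adj v u].
  have dot_x w : dot Q x w = - (k w : nat)%:R.
    rewrite /dot; under eq_bigr do rewrite ffunE mulr_suml.
    rewrite exchange_big /=; under eq_bigr do under eq_bigr do rewrite -mulrA.
    under eq_bigr do rewrite -mulr_sumr -/(dot Q _ _) dot_Estar mulrN.
    rewrite (bigD1 w) //= eqxx mulr1 big1 ?addr0 // => v neq_vw.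
    by rewrite (negbTE neq_vw) mulr0 oppr0.
  transitivity (x == l).
    apply/forallP/eqP=> [eq_x|<- u]; last by rewrite ffunE.
    by apply/ffunP=> u; rewrite ffunE; apply/eqP.
  apply/eqP/forallP=> [x_l w|eq_k].
    apply/eqP/(@intr_inj rat); have := dot_x w; rewrite x_l dot_expo rmorphN.
    by move/oppr_inj=> ->.
  by apply: dot_inj => w; rewrite dot_x dot_expo -(eqP (eq_k w)) rmorphN.
rewrite (eq_bigl _ _ cond).
have [/forallP d_ge0|/forallPn[v d_v]] := boolP [forall v, 0 <= expo d v]; last first.
  rewrite big_pred0 => [|k].
    by rewrite (bigD1 v) //=; case: (expo d v) d_v => // k _; rewrite mul0r.
  by apply/negbTE; apply: contra d_v => /forallP/(_ v)/eqP<-.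
have bound v : (`|expo d v| < N)%N.
  rewrite /N /zbound ltnS (bigD1 v) //= (leq_trans _ (leq_addr _ _)) //.
  have l_v : (expo d v)%:~R * Estar e adj v v <= l v.
    suff -> : l v = \sum_w (expo d w)%:~R * Estar e adj w v.
      rewrite (bigD1 v) //= lerDl sumr_ge0 // => w _.
      by rewrite mulr_ge0 ?ler0z ?d_ge0 ?Estar_ge0.
    pose x : qvec n := [ffun u => \sum_w (expo d w)%:~R * Estar e adj w u].
    suff -> : l = x by rewrite ffunE.
    apply: dot_inj => u; rewrite dot_expo /dot.
    under [RHS]eq_bigr do rewrite ffunE mulr_suml.
    rewrite exchange_big /=; under eq_bigr do under eq_bigr do rewrite -mulrA.
    under eq_bigr do rewrite -mulr_sumr -/(dot Q _ _) dot_Estar mulrN.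
    rewrite (bigD1 u) //= eqxx mulr1 big1 ?addr0 ?rmorphN // => w neq_wu.
    by rewrite (negbTE neq_wu) mulr0 oppr0.
  have le_q : (expo d v)%:~R <= l v / Estar e adj v v by rewrite ler_pdivlMr ?Estar_gt0.
  rewrite truncn_ge_nat; last by apply: le_trans le_q; rewrite ler0z.
  by rewrite -[X in X <= _]/((Posz `|expo d v|)%:~R) gez0_abs.
pose k0 : {ffun 'I_n -> 'I_N} := [ffun v => Ordinal (bound v)].
rewrite (big_pred1 k0) => [|k].
  apply: eq_bigr => v _; rewrite ffunE /=.
  by have := d_ge0 v; case: (expo d v).
apply/forallP/eqP=> [k_d|-> v]; last by rewrite ffunE /= gez0_abs.
apply/ffunP=> v; apply: val_inj; rewrite ffunE /=.
by apply/eqP; rewrite -eqz_nat gez0_abs // k_d.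
Qed.

End Translation.

(** * The NN-elliptic sequence in integral coordinates *)

Lemma CsumS n (Zs : nat -> qvec n) k : Csum Zs k.+1 = Csum Zs k + Zs k.+1.
Proof. by rewrite /Csum big_ord_recr. Qed.

(** Faithful on integral vectors, whose coordinates equal their numerators. *)
Definition int_part n (x : qvec n) : zvec n := [ffun v => numq (x v)].

Lemma int_partK n (x : qvec n) : isInt x -> zq (int_part x) = x.
Proof. by case=> l ->; apply/ffunP=> u; rewrite !ffunE numq_int. Qed.

Lemma isInt_zq n (l : zvec n) : isInt (zq l). Proof. by exists l. Qed.

Lemma leV_zq n (k l : zvec n) : leV (zq k) (zq l) <-> forall u, k u <= l u.
Proof. by split=> le_kl u; have := le_kl u; rewrite !ffunE ler_int. Qed.

Lemma leV0_zq n (l : zvec n) : leV 0 (zq l) <-> forall u, 0 <= l u.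
Proof. by split=> le_l u; have := le_l u; rewrite !ffunE ler0z. Qed.

Lemma supp_zq n (l : zvec n) : supp (zq l) = [set u | l u != 0].
Proof. by apply/setP=> u; rewrite !inE ffunE intr_eq0. Qed.

Lemma edges_setT n (adj : rel 'I_n) :
  edges adj setT = #|[set p : 'I_n * 'I_n | adj p.1 p.2]|.
Proof.
rewrite -sum1_card big_mkcond /= (eq_bigr (fun p => (adj p.1 p.2 : nat))).
  by rewrite -(pair_bigA _ (fun u w => (adj u w : nat))) /edges /degree; apply: eq_big => u;
     rewrite ?inE // => _; apply: eq_bigl => w; rewrite inE.
by move=> p _; rewrite inE; case: adj.
Qed.

Lemma degree_setT n (adj : rel 'I_n) v : degree adj setT v = valency adj v.
Proof.
by rewrite /valency -sum1_card [RHS]big_mkcond /degree; apply: eq_big => w; rewrite inE.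
Qed.

Section Sequence.
Variables (n : nat) (e : 'I_n -> int) (adj : rel 'I_n) (M : nat) (Zs : nat -> qvec n).
Hypothesis negI : neg_definite e adj.
Hypothesis seqZ : is_NN_seq e adj M Zs.

Local Notation A := (imx e adj).
Local Notation K := (ZK e adj).
Local Notation Q := (fun u w => Imx e adj u w).

(** By the index shift of [Csum] this is [Z_K - C_{k-1}], integral for [k <= M] because [s_{[Z_K]}]
    lies in the class of [Z_K]. *)
Definition remainder k : zvec n := int_part (K - Csum Zs k).

Lemma remainderE k : (k <= M)%N -> zq (remainder k) = K - Csum Zs k.
Proof.
have [[_ [l Dl] _] stepZ _] := seqZ; move=> le_kM; apply: int_partK.
elim: k le_kM => [_|k IHk lt_kM].
  by exists (- l); rewrite /Csum big_ord1 zqN -Dl opprB.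
have [_ [[[z Dz] _ _] _ _]] := stepZ k.+1 lt_kM; have [y Dy] := IHk (ltnW lt_kM).
by exists (y - z); rewrite CsumS zqD zqN -Dy -Dz opprD addrA.
Qed.

Lemma remainder0_expo v : 0 <= expo A (- remainder 0) v.
Proof.
have [[[_ Z0S] _ _] _ _] := seqZ; have := Z0S v; rewrite form_Ebas.
have -> : Zs 0%N = K + zq (- remainder 0).
  by rewrite zqN remainderE // /Csum big_ord1 opprB addrC subrK.
by rewrite dot_expo // rmorphN oppr_le0 ler0z.
Qed.

Lemma remainder0_min x : (forall v, 0 <= expo A x v) -> forall v, (- remainder 0) v <= x v.
Proof.
move=> xK; have [[_ _ Z0_min] _ _] := seqZ.
have := Z0_min (K + zq x) _ _; have -> : Zs 0%N = K + zq (- remainder 0).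
  by rewrite zqN remainderE // /Csum big_ord1 opprB addrC subrK.
move=> le_y v; have := le_y _ _ v; rewrite ![(K + _) v]ffunE lerD2l !ffunE ler_int; apply.
  split=> u; rewrite form_Ebas dot_expo //; first by exists (- expo A x u).
  by rewrite lerz0 oppr_le0.
by exists x; rewrite addrAC subrr add0r.
Qed.

Lemma remainder_last : remainder M = 0.
Proof.
have [_ _ KM] := seqZ; apply: zq_inj.
by rewrite remainderE // -KM subrr zq0.
Qed.

Lemma remainder_step k : (k < M)%N -> zmin_step A (remainder k) (remainder k.+1).
Proof.
move=> lt_kM; have [_ stepZ _] := seqZ; have [] := stepZ k.+1 lt_kM; rewrite /=.
have DZ : Zs k.+1 = zq (remainder k - remainder k.+1).
  by rewrite zqD zqN !remainderE ?(ltnW lt_kM) // CsumS; apply/ffunP=> u; rewrite !ffunE; ring.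
rewrite -(remainderE (ltnW lt_kM)) DZ zq_eq0 supp_zq => y_neq0 [[_ /subsetP supZ ZS] Z_neq0 Zmin].
split=> //.
- move=> v yv; have := supZ v; rewrite supp_zq !inE yv eqxx !vE yv sub0r oppr_eq0.
  by case: eqP => // _ /(_ isT).
- by move=> v yv; have := ZS v; rewrite inE form_Ebas dot_zq lerz0; apply.
- by rewrite -zq_eq0.
move=> Y Y0 YS Y_neq0; apply/leV_zq; apply: Zmin; rewrite ?zq_eq0 //.
split; first exact: isInt_zq.
  rewrite supp_zq; apply/subsetP=> v; rewrite !inE; apply: contraNneq => /Y0 ->.
  by [].
by move=> v; rewrite inE form_Ebas dot_zq lerz0; apply: YS.
Qed.

End Sequence.

(* P_0(t_{|C|}) = sum_{j=-1}^{m-1} t_{|C|}^{Z_K - E - C_j}, stated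
   coefficientwise: for every monomial exponent a (only a_v, v in |C|,
   matter), the fibre { ell in L : ell_v = a_v for v in |C| } carries only
   finitely many nonzero coefficients of P_0, and their sum equals the number
   of j in {-1,...,m-1} (k = j + 1 in {0,...,M-1}) with
   (Z_K - E - C_j)_v = a_v for all v in |C|. *)
Theorem mainTheorem4 (n : nat) (e : 'I_n -> int) (adj : rel 'I_n)
  (M : nat) (Zs : nat -> qvec n) (C : qvec n) :
  is_tree adj -> neg_definite e adj -> elliptic e adj ->
  is_NN_seq e adj M Zs -> is_min_ell_cycle e adj C ->
  forall a : zvec n,
    exists s : seq (zvec n),
      [/\ uniq s,
          (forall ell : zvec n, [forall u in supp C, ell u == a u] ->
             P0coef e adj ell != 0 -> ell \in s)
        & \sum_(ell <- s | [forall u in supp C, ell u == a u]) P0coef e adj ell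
          = (#|[set k : 'I_M | [forall u in supp C,
                 (a u)%:~R == (ZK e adj - Eall n - Csum Zs k) u]]|)%:Z].
Proof.
move=> [n_gt0 adjC adj_irr conn card_edges] negI [e_le [chi_ge0 _]] seqZ minC a.
have [[c ->] C_ge0 C_neq0 chi_C C_min] := minC.
pose A := imx e adj.
have chi2_pos (l : zvec n) : (0 <= chi e adj (zq l)) = (0 <= chi2 A l).
  by rewrite chi_zq // pmulr_lge0 ?ler0z // invr_gt0.
have ellA (x : zvec n) : (forall u, 0 <= x u) -> 0 <= chi2 A x.
  move=> x_ge0; rewrite -chi2_pos; have [->|x_neq0] := eqVneq x 0; last first.
    by apply: chi_ge0; rewrite ?zq_eq0 //; [exact: isInt_zq | exact/leV0_zq].
  rewrite chi2_pos /chi2 /bil !big1 ?subrr // => v _; first by rewrite ffunE mulr0.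
  by rewrite ffunE mul0r.
have cA_min (l : zvec n) : (forall u, 0 <= l u) -> l != 0 -> (forall u, l u <= c u) -> l != c ->
    0 < chi2 A l.
  move=> l_ge0 l_neq0 l_le l_neq; have := C_min (zq l); rewrite chi_zq // pmulr_lgt0 ?invr_gt0 // ltr0z.
  apply; rewrite ?zq_eq0 //; [exact: isInt_zq | exact/leV0_zq | exact/leV_zq |].
  by apply: contra l_neq => /eqP/zq_inj->.
have chi_c : chi2 A c = 0.
  apply/eqP; rewrite -(@intr_eq0 rat); move/eqP: chi_C; rewrite chi_zq // mulf_eq0 invr_eq0.
  by rewrite (_ : (2 : rat) == 0 = false) // orbF.
have diagA v : A v v <= -2 by rewrite /A imx_diag.
have A_adj u w : u != w -> A u w = (adj u w)%:Z by rewrite /A /imx => /negbTE->.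
have tree_e : edges adj setT = (2 * n.-1)%N by rewrite edges_setT.
have [D D_lt0] := exists_ample negI.
have c_neq0 : c != 0 by rewrite -zq_eq0.
(* With [x = -1 - ell] one has [Z_K - E - ell = Z_K + x], and [ell] negative in all coordinates
   becomes [x >= 0]. *)
pose d : zvec n := [ffun u => - 1 - a u].
pose flip (x : zvec n) : zvec n := [ffun u => - 1 - x u].
have flipK : involutive flip by move=> x; apply/ffunP=> u; rewrite !ffunE; ring.
have [l [uniq_l l_fib l_all sum_l]] := fibre_truncated_sum (imxC e adjC) (@imx_ge0 _ e adj)
  (imx_lt0 negI) diagA D_lt0 (imx_connected e adjC conn) ellA (proj1 (leV0_zq c) C_ge0) c_neq0
  chi_c cA_min adjC adj_irr A_adj tree_e d (remainder0_expo negI seqZ)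
  (remainder0_min negI seqZ) (remainder_last seqZ) (remainder_step seqZ).
have P0E x : P0coef e adj (flip x) = if [forall u, 0 <= x u] then 0 else redz A adj setT x.
  rewrite /P0coef; have -> : [forall u, flip x u < 0] = [forall u, 0 <= x u].
    by apply: eq_forallb => u; rewrite ffunE; move: (x u); clear; lia.
  case: ifP => // _; have -> : ZK e adj - Eall n - zq (flip x) = ZK e adj + zq x.
    by apply/ffunP=> u; rewrite !ffunE rmorphB rmorphN; ring.
  rewrite zcoefE // /redz; apply: eq_big => v; first by rewrite inE.
  by rewrite degree_setT.
have fibE x : [forall u in supp (zq c), flip x u == a u] = fibre (suppC c) d x.
  rewrite supp_zq; apply: eq_forallb => u; rewrite !inE; congr (_ ==> _).
  by rewrite !ffunE; move: (x u) (a u); clear; lia.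
exists (map flip l); split.
- by rewrite map_inj_uniq //; exact: can_inj flipK.
- move=> x; rewrite -{1 2 3}(flipK x) fibE P0E => x_fib Px.
  by rewrite mem_map ?l_all //; exact: can_inj flipK.
rewrite big_map big_seq_cond (eq_bigl (fun x => x \in l)) => [|x]; last first.
  by rewrite fibE andb_idr // => /l_fib.
rewrite -big_seq (eq_bigr _ (fun x _ => P0E x)) sum_l; congr Posz.
apply: eq_card => k; rewrite !inE supp_zq; apply: eq_forallb => u.
rewrite inE; congr (_ ==> _).
have -> : ZK e adj - Eall n - Csum Zs k = zq (remainder e adj Zs k) - Eall n.
  by rewrite (remainderE seqZ (ltnW (ltn_ord k))) addrAC.
move: (remainder e adj Zs k) => r; rewrite !ffunE.
have -> : (r u)%:~R - 1 = (r u - 1)%:~R :> rat by rewrite rmorphB.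
rewrite eqr_int.
by move: (a u) (r u); clear; lia.
Qed.
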